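(* In the algebra $\hat{\mathcal K}$ define, for $i,j\in\{1,\dots,n\}$, $\overline t_{ji}=0$ if $i<j$, $\overline t_{ij}=-(v^{-1}-v)\,E_{ij}(\underline i)$ if $i<j$, and $\overline t_{ii}=0(\underline i)$, and let $\mathcal U$ be the subalgebra of $\hat{\mathcal K}$ generated by all $\overline t_{ij}$. Then the generators of $\mathcal U$ satisfy, for all $i,j,a,b\in\{1,\dots,n\}$, $$v^{-\delta_{ij}}\,\overline t_{ia}\overline t_{jb}-v^{-\delta_{ab}}\,\overline t_{jb}\overline t_{ia}=(v^{-1}-v)(\delta_{b<a}-\delta_{i<j})\,\overline t_{ja}\overline t_{ib}.$$
   Context: Fix a positive integer $n$. For each $d\ge1$ and each finite field $\mathbb F_q$ (with $q$ elements, odd characteristic) let $\mathscr X$ be the set of flags $V=(0=V_0\subseteq V_1\subseteq\cdots\subseteq V_n=\mathbb F_q^d)$ with its action of $G=GL(\mathbb F_q^d)$. Let $\Theta_d$ be the set of $n\times n$ matrices over $\mathbb N=\{0,1,\dots\}$ with entries summing to $d$; it parametrizes the diagonal $G$-orbits on $\mathscr X\times\mathscr X$, the orbit $\mathcal O_A$ of $(V,V')$ corresponding to the matrix $A$ with $(i,j)$-entry $\dim\frac{V_{i-1}+V_i\cap V'_j}{V_{i-1}+V_i\cap V'_{j-1}}$. Let $v$ be an indeterminate, $\mathcal A=\mathbb Z[v,v^{-1}]$, and let $\mathcal S_d$ be the $\mathcal A$-algebra with free basis $\{e_A:A\in\Theta_d\}$ (characteristic functions of orbits) whose structure constants specialize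 at $v=\sqrt q$, for every $q$, to those of convolution $(f*g)(V,V')=\sum_{V''\in\mathscr X}f(V,V'')g(V'',V')$. Put $[A]=v^{-\sum_{i\ge k,\,j<l}a_{ij}a_{kl}}e_A$ for $A=(a_{ij})\in\Theta_d$. Let $\widetilde\Theta$ be the set of $n\times n$ integer matrices whose off-diagonal entries are $\ge0$; for $A\in\widetilde\Theta$ and $p\in\mathbb N$ put ${}_pA=A+pI$ ($I$ the identity matrix). For a matrix $M$, $\mathrm{ro}(M)$ and $\mathrm{co}(M)$ denote the vectors of row sums and of column sums. Known stabilization result (Beilinson–Lusztig–MacPherson): if $A_1,\dots,A_r\in\widetilde\Theta$ ($r\ge2$) satisfy $\mathrm{co}(A_i)=\mathrm{ro}(A_{i+1})$ for $1\le i\le r-1$, there are $Z_1,\dots,Z_m\in\widetilde\Theta$, $G_j(v,v')\in\mathbb Q(v)[v']$ ($v'$ another indeterminate) and $p_0\in\mathbb N$ such that $[{}_pA_1]*\cdots*[{}_pA_r]=\sum_{j=1}^mG_j(v,v^{-p})[{}_pZ_j]$ (in the appropriate $\mathcal S_d$) for all $p\ge p_0$. Let $\mathcal K$ be the free $\mathcal A$-module on formal symbols $[A]$, $A\in\widetilde\Theta$, with the associative (non-unital) product given by $[A_1]\cdot[A_2]\cdots[A_r]=\sum_jG_j(v,1)[Z_j]$ in that situation, and with $[A]\cdot[B]=0$ if $\mathrm{co}(A)\ne\mathrm{ro}(B)$. $\hat{\mathcal K}$ is the $\mathbb Q(v)$-vector space of formal sums $\sum_{A\in\widetilde\Theta}\xi_A[A]$,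 $\xi_A\in\mathbb Q(v)$, such that for each $\mathbf t\in\mathbb Z^n$ the sets $\{A:\mathrm{ro}(A)=\mathbf t,\xi_A\ne0\}$ and $\{A:\mathrm{co}(A)=\mathbf t,\xi_A\neq0\}$ are finite; it is an associative $\mathbb Q(v)$-algebra with product $\sum_A\xi_A[A]\cdot\sum_B\xi'_B[B]=\sum_{A,B}\xi_A\xi'_B\,[A]\cdot[B]$. For $\hat A\in\widetilde\Theta$ with zero diagonal and $\mathbf j=(j_1,\dots,j_n)\in\mathbb Z^n$ put $\hat A(\mathbf j)=\sum_{\lambda\in\mathbb Z^n}v^{\lambda_1j_1+\cdots+\lambda_nj_n}[\hat A+D_\lambda]\in\hat{\mathcal K}$, where $D_\lambda$ is the diagonal matrix with entries $\lambda_1,\dots,\lambda_n$. $E_{ij}$ is the matrix unit, $0$ in $0(\mathbf j)$ is the zero matrix, $\underline i\in\mathbb N^n$ is the vector with $i$-th entry $1$ and other entries $0$; $\delta_{ij}$ is the Kronecker delta and $\delta_{b<a}$ is $1$ if $b<a$ and $0$ otherwise. *)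

(* Defs.v *)
From HB Require Import structures.
From mathcomp Require Import all_boot all_order all_algebra all_field.
From mathcomp Require Import boolp classical_sets functions cardinality fsbigop.

Set Implicit Arguments.
Unset Strict Implicit.
Unset Printing Implicit Defensive.

Import Order.TTheory GRing.Theory Num.Theory.

Local Open Scope classical_set_scope.
Local Open Scope ring_scope.

(* The library only makes {vspace vT} a choiceType. *)
HB.instance Definition _ (F : finFieldType) (vT : vectType F) :
    isCountable {vspace vT} :=
  CanIsCountable (@VectorInternalTheory.vs2mxK F vT).
HB.instance Definition _ (F : finFieldType) (vT : vectType F) :
    isFinite {vspace vT} :=
  CanIsFinite (@VectorInternalTheory.vs2mxK F vT).

(* The field Q(v). *)
Notation Qv := {fraction {poly rat}}.
Notation qv := (tofrac ('X : {poly rat}) : Qv).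

(* Everything indexed by Theta_d or by \widetilde\Theta is indexed by 'M[int]_n,
   Theta_d and \widetilde\Theta being predicates on integer matrices. *)

Definition inTheta (n d : nat) (A : 'M[int]_n) : bool :=
  [forall i, forall j, 0 <= A i j] && (\sum_i \sum_j A i j == d%:Z).

Definition inThetaTilde (n : nat) (A : 'M[int]_n) : bool :=
  [forall i, forall j, (i != j) ==> (0 <= A i j)].

Definition ro (n : nat) (A : 'M[int]_n) : 'rV[int]_n := \row_i \sum_j A i j.
Definition co (n : nat) (A : 'M[int]_n) : 'rV[int]_n := \row_j \sum_i A i j.

Definition shift (n p : nat) (A : 'M[int]_n) : 'M[int]_n := A + (p%:Z)%:M.

(* Flags V_0 <= ... <= V_n; for the 0-based index i : 'I_n of the i.+1-st step,
   V_i and V_(i+1) are V (widen_ord (leqnSn n) i) and V (lift ord0 i). *)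
Definition is_flag (F : finFieldType) (n d : nat)
    (V : {ffun 'I_n.+1 -> {vspace 'rV[F]_d}}) : bool :=
  [&& V ord0 == 0%VS, V ord_max == fullv
    & [forall i : 'I_n, V (widen_ord (leqnSn n) i) <= V (lift ord0 i)]%VS].

Definition flag (F : finFieldType) (n d : nat) : finType :=
  {V : {ffun 'I_n.+1 -> {vspace 'rV[F]_d}} | is_flag V}.

(* The matrix of the G-orbit of (V, V'); O_A is the set of pairs with
   relpos V V' = A.  The subtrahend is the dimension of a subspace, so the
   natural number subtraction does not truncate. *)
Definition relpos (F : finFieldType) (n d : nat) (V V' : flag F n d) :
    'M[int]_n :=
  \matrix_(i, j)
    (let Vi0 := val V (widen_ord (leqnSn n) i) in
     let Vi1 := val V (lift ord0 i) in
     let V'j0 := val V' (widen_ord (leqnSn n) j) in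
     let V'j1 := val V' (lift ord0 j) in
     (\dim (Vi0 + (Vi1 :&: V'j1)) - \dim (Vi0 + (Vi1 :&: V'j0)))%N%:Z).

(* g in Z[v, 1/v] is the coefficient of e_C in e_A * e_B: it is P(v) / v^m with
   P an integer polynomial, and for every finite field of odd characteristic
   its value at v = sqrt q is the value of the convolution of the
   characteristic functions of O_A and O_B at any pair (V, V') in O_C. *)
Definition is_schur_const (n d : nat) (A B C : 'M[int]_n) (g : Qv) : Prop :=
  exists (P : {poly int}) (m : nat),
    g = tofrac (map_poly intr P : {poly rat}) / qv ^+ m /\
    forall (F : finFieldType), 2%N \notin [pchar F] ->
      forall V V' : flag F n d, relpos V V' = C ->
        (map_poly intr P : {poly algC}).[sqrtC (#|F|%:R)]
          / sqrtC (#|F|%:R) ^+ m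
        = #|[set V'' : flag F n d |
             (relpos V V'' == A) && (relpos V'' V' == B)]%SET|%:R.

(* Such a g exists and is unique for A, B, C in Theta_d; the default 0 is
   never taken. *)
Definition schur_const (n d : nat) (A B C : 'M[int]_n) : Qv :=
  xget 0 [set g | is_schur_const d A B C g].

(* An element of Q(v) (x) S_d is the family of its coordinates in the basis
   (e_A), A in Theta_d; only the values at A in Theta_d matter. *)
Definition schur_mul (n d : nat) (f g : 'M[int]_n -> Qv) : 'M[int]_n -> Qv :=
  fun C => if inTheta d C then
    \sum_(A \in [set A : 'M[int]_n | inTheta d A])
      \sum_(B \in [set B : 'M[int]_n | inTheta d B])
        f A * g B * schur_const d A B C
  else 0.

Definition br_exponent (n : nat) (A : 'M[int]_n) : int :=
  \sum_(i < n) \sum_(k < n | (k <= i)%N)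
    \sum_(j < n) \sum_(l < n | (j < l)%N) A i j * A k l.

(* [A] = v^(- br_exponent A) e_A in S_d. *)
Definition schur_br (n : nat) (A : 'M[int]_n) : 'M[int]_n -> Qv :=
  fun C => if C == A then qv ^ (- br_exponent A) else 0.

(* s is a list of pairs (Z_j, G_j) with
   [pA] * [pB] = \sum_j G_j(v, v^-p) [pZ_j] for all large p.  A coefficient of
   [pA] * [pB] vanishes outside the matrices with the row sums of pA and the
   column sums of pB, so the condition on ro and co only excludes terms
   with G_j = 0. *)
Definition stabilizes (n : nat) (A B : 'M[int]_n)
    (s : seq ('M[int]_n * {poly Qv})) : Prop :=
  (forall Z G, (Z, G) \in s ->
     [/\ inThetaTilde Z, ro Z = ro A & co Z = co B]) /\
  exists p0 : nat, forall p : nat, (p0 <= p)%N ->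
    exists d : nat,
      [/\ inTheta d (shift p A), inTheta d (shift p B),
          forall Z G, (Z, G) \in s -> inTheta d (shift p Z)
        & schur_mul d (schur_br (shift p A)) (schur_br (shift p B)) =1
          fun C => \sum_(ZG <- s) ZG.2.[qv ^- p] * schur_br (shift p ZG.1) C].

(* Coefficient of [C] in the product [A].[B] of K, for A, B in
   \widetilde\Theta.  When co A = ro B a stabilizing list exists, and the sum
   below does not depend on its choice. *)
Definition K_const (n : nat) (A B C : 'M[int]_n) : Qv :=
  if co A == ro B then
    \sum_(ZG <- xget [::] [set s | stabilizes A B s] | ZG.1 == C) ZG.2.[1]
  else 0.

Lemma K_const_neq0 (n : nat) (A B C : 'M[int]_n) : K_const A B C != 0 ->
  [/\ co A = ro B, inThetaTilde C, ro C = ro A & co C = co B].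
Proof.
rewrite /K_const; case: (co A =P ro B) => [coA|_]; last by rewrite eqxx.
case: xgetP => [s _ [sP _]|_]; last by rewrite big_nil eqxx.
move=> sum_neq0; have : has (fun ZG => ZG.1 == C) s.
  by apply: contraNT sum_neq0 => /hasPn nC; rewrite big_seq_cond big1 // => ZG
    /andP[/nC /negPf->].
by case/hasP=> -[Z G] /sP[? ? ?] /= /eqP <-.
Qed.

Lemma K_const_finite (n : nat) (A B : 'M[int]_n) :
  finite_set [set C | K_const A B C != 0].
Proof.
rewrite /K_const; case: (co A == ro B); last first.
  by apply: sub_finite_set (@finite_set0 _) => C /= /eqP.
set s := xget _ _; apply: sub_finite_set (finite_seq (map fst s)) => C /=.
apply: contraNT => nC; rewrite big_seq_cond big1 // => ZG /andP[sZG /eqP ZC].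
by case/negP: nC; apply/mapP; exists ZG.
Qed.

Definition in_hatK (n : nat) : {pred 'M[int]_n -> Qv^o} :=
  [pred f | `[< (forall A, f A != 0 -> inThetaTilde A) /\
                forall t : 'rV[int]_n,
                  finite_set [set A | ro A = t /\ f A != 0] /\
                  finite_set [set A | co A = t /\ f A != 0] >]].

Record hatK (n : nat) := HatK {
  hatK_coef :> 'M[int]_n -> Qv^o;
  _ : hatK_coef \in @in_hatK n
}.

HB.instance Definition _ (n : nat) := [isSub for @hatK_coef n].
HB.instance Definition _ (n : nat) := [Choice of hatK n by <:].

Lemma in_hatK_submod_closed (n : nat) : submod_closed (@in_hatK n).
Proof.
split=> [|a f g /asboolP[f1 f2] /asboolP[g1 g2]]; apply/asboolP.
  split=> [A|t]; first by rewrite eqxx.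
  by split; apply: sub_finite_set (@finite_set0 _) => A /= []; rewrite eqxx.
have fg A : (a *: f + g) A != 0 -> f A != 0 \/ g A != 0.
  case: (eqVneq (f A) 0) => [f0|]; last by left.
  case: (eqVneq (g A) 0) => [g0|]; last by right.
  by rewrite /GRing.add/= /GRing.scale/= f0 g0 scaler0 addr0 eqxx.
split=> [A /fg[/f1|/g1]//|t]; have [fr fc] := f2 t; have [gr gc] := g2 t.
split.
  apply: (@sub_finite_set _ _
    ([set A | ro A = t /\ f A != 0] `|` [set A | ro A = t /\ g A != 0])).
    by move=> A /= [-> /fg[]]; [left|right].
  rewrite finite_setU; exact: (conj fr gr).
apply: (@sub_finite_set _ _
  ([set A | co A = t /\ f A != 0] `|` [set A | co A = t /\ g A != 0])).
  by move=> A /= [-> /fg[]]; [left|right].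
rewrite finite_setU; exact: (conj fc gc).
Qed.

HB.instance Definition _ (n : nat) :=
  GRing.isSubmodClosed.Build Qv ('M[int]_n -> Qv^o) (@in_hatK n)
    (@in_hatK_submod_closed n).
HB.instance Definition _ (n : nat) := [SubChoice_isSubLmodule of hatK n by <:].

(* The sum over (A, B) has finite support by the finiteness conditions. *)
Definition hatK_mul_coef (n : nat) (x y : 'M[int]_n -> Qv^o) :
    'M[int]_n -> Qv^o :=
  fun C => \sum_(AB \in [set: 'M[int]_n * 'M[int]_n])
    (x AB.1 * y AB.2 * K_const AB.1 AB.2 C : Qv).

Lemma hatK_mul_subproof (n : nat) (x y : hatK n) :
  hatK_mul_coef x y \in @in_hatK n.
Proof.
case: x y => [x /= /asboolP[x1 x2]] [y /= /asboolP[y1 y2]]; apply/asboolP.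
have xyP C : hatK_mul_coef x y C != 0 ->
    exists A B, [/\ x A != 0, y B != 0 & K_const A B C != 0].
  move=> xyC; apply: contrapT => nAB; case/negP: xyC; apply/eqP.
  apply: fsbig1 => -[A B] _ /=; apply: contrapT => /eqP.
  rewrite !mulf_eq0 !negb_or => /andP[/andP[xA yB] cC].
  apply: nAB; exists A, B; split; [exact: xA | exact: yB | exact: cC].
split=> [C /xyP[A [B [_ _ /K_const_neq0[_ CT _ _]]]]|t]; first exact: CT.
split.
  apply: (@sub_finite_set _ _
    (\bigcup_(A in [set A | ro A = t /\ x A != 0])
      \bigcup_(B in [set B | ro B = co A /\ y B != 0])
        [set C | K_const A B C != 0])).
    move=> C /= [roC /xyP[A [B [xA yB cC]]]].
    have [coA _ roCA _] := K_const_neq0 cC.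
    exists A; first by split; [rewrite -roCA; exact: roC | exact: xA].
    by exists B; [split; [exact: esym coA | exact: yB] | exact: cC].
  apply: bigcup_finite => [|A _]; first by have [fr _] := (x2 t); exact: fr.
  apply: bigcup_finite => [|B _]; first by have [fr _] := (y2 (co A)); exact: fr.
  exact: K_const_finite.
apply: (@sub_finite_set _ _
  (\bigcup_(B in [set B | co B = t /\ y B != 0])
    \bigcup_(A in [set A | co A = ro B /\ x A != 0])
      [set C | K_const A B C != 0])).
  move=> C /= [coC /xyP[A [B [xA yB cC]]]].
  have [coA _ _ coCB] := K_const_neq0 cC.
  exists B; first by split; [rewrite -coCB; exact: coC | exact: yB].
  by exists A; [split; [exact: coA | exact: xA] | exact: cC].
apply: bigcup_finite => [|B _]; first by have [_ fc] := (y2 t); exact: fc.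
apply: bigcup_finite => [|A _]; first by have [_ fc] := (x2 (ro B)); exact: fc.
exact: K_const_finite.
Qed.

Definition hatK_mul (n : nat) (x y : hatK n) : hatK n :=
  HatK (hatK_mul_subproof x y).

(* The coefficients of \hat A(j) = \sum_lambda v^(lambda . j) [\hat A + D_lambda].
   The matrix \hat A is given with entries in nat, so that
   \hat A + D_lambda is in \widetilde\Theta. *)
Definition hatA_coef (n : nat) (Ahat : 'M[nat]_n) (j : 'rV[int]_n) :
    'M[int]_n -> Qv^o :=
  fun C => \sum_(lam \in [set: 'rV[int]_n])
    (if C == map_mx Posz Ahat + diag_mx lam
     then qv ^ (\sum_i lam 0 i * j 0 i) else 0 : Qv).

Lemma hatA_subproof (n : nat) (Ahat : 'M[nat]_n) (j : 'rV[int]_n) :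
  hatA_coef Ahat j \in @in_hatK n.
Proof.
have hatP C : hatA_coef Ahat j C != 0 ->
    exists lam, C = map_mx Posz Ahat + diag_mx lam.
  move=> hC; apply: contrapT => nlam; case/negP: hC; apply/eqP.
  apply: fsbig1 => lam _ /=; case: eqP => // Clam.
  by case: nlam; exists lam.
have roD lam : ro (map_mx Posz Ahat + diag_mx lam) =
    ro (map_mx Posz Ahat) + lam.
  apply/rowP=> i; rewrite !mxE.
  have -> : lam 0 i = \sum_k diag_mx lam i k.
    rewrite (bigD1 i) //= big1 => [|k]; first by rewrite mxE eqxx addr0.
    by rewrite mxE eq_sym => /negPf->.
  by rewrite -big_split; apply: eq_bigr => k _; rewrite !mxE.
have coD lam : co (map_mx Posz Ahat + diag_mx lam) =
    co (map_mx Posz Ahat) + lam.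
  apply/rowP=> i; rewrite !mxE.
  have -> : lam 0 i = \sum_k diag_mx lam k i.
    rewrite (bigD1 i) //= big1 => [|k]; first by rewrite mxE eqxx addr0.
    by rewrite mxE => /negPf->.
  by rewrite -big_split; apply: eq_bigr => k _; rewrite !mxE.
apply/asboolP; split=> [C /hatP[lam ->]|t].
  apply/forallP=> i; apply/forallP=> k; apply/implyP=> /negPf ik.
  by rewrite !mxE ik addr0.
split.
  apply: sub_finite_set
    (finite_set1 (map_mx Posz Ahat + diag_mx (t - ro (map_mx Posz Ahat)))).
  by move=> C /= [<- /hatP[lam ->]]; rewrite roD [ro _ + lam]addrC addrK.
apply: sub_finite_set
  (finite_set1 (map_mx Posz Ahat + diag_mx (t - co (map_mx Posz Ahat)))).
by move=> C /= [<- /hatP[lam ->]]; rewrite coD [co _ + lam]addrC addrK.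
Qed.

Definition hatA (n : nat) (Ahat : 'M[nat]_n) (j : 'rV[int]_n) : hatK n :=
  HatK (hatA_subproof Ahat j).

Definition underline (n : nat) (i : 'I_n) : 'rV[int]_n := delta_mx 0 i.

Definition tbar (n : nat) (i j : 'I_n) : hatK n :=
  if (i < j)%N then (- (qv^-1 - qv)) *: hatA (delta_mx i j) (underline i)
  else if i == j then hatA 0 (underline i)
  else 0.

(* Subalgebras contain the unit element 0(0) of \hat K. *)
Definition is_subalgebra (n : nat) (S : set (hatK n)) : Prop :=
  [/\ S (hatA 0 0),
      forall x y, S x -> S y -> S (x + y),
      forall (c : Qv) x, S x -> S (c *: x)
    & forall x y, S x -> S y -> S (hatK_mul x y)].

Definition algU (n : nat) : set (hatK n) :=
  [set x | forall S : set (hatK n), is_subalgebra S ->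
     (forall i j, S (tbar i j)) -> S x].

(* Main.v *)
Require Import Defs.
From HB Require Import structures.
From mathcomp Require Import all_boot all_order all_algebra all_field.
From mathcomp Require Import boolp classical_sets functions cardinality fsbigop.
From mathcomp Require Import zify ring.

Set Implicit Arguments.
Unset Strict Implicit.
Unset Printing Implicit Defensive.

Import Order.TTheory GRing.Theory Num.Theory.

Local Open Scope ring_scope.

(** Write [T_ia] for the sum over [lam] of [v^lam_i [E_ia + D_lam]] ([i <= a]), so that
    tbar_ia is a multiple of [T_ia].  For flags V, V'' in relative position
    [E_ia + D_lam], the flag V'' lies in V and V / V'' is an interval module of the
    linear quiver; hence the structure constants of [E_ia + D_lam] * [E_jb + D_mu]
    are Hall numbers of extensions of two interval modules, and only the matrices
    [E_ia + E_jb + D_nu] and [E_ib + E_ja + D_nu] occur.  An intermediate flag is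
    determined by a line in the quotient of two subspaces, and counting these
    lines gives 1, q - 1, q or q + 1.  After normalization the coefficients do not
    depend on the diagonal, so stabilization is immediate and they are the
    structure constants of K.  Each of the three products in the relation is
    therefore a combination of the same two families, and comparing their
    coefficients is a finite case analysis. *)

(** * Chains of subspaces *)

Section Chains.
Variables (F : fieldType) (vT : vectType F).
Implicit Types (U V W : {vspace vT}) (X Y Z : nat -> {vspace vT}).

Lemma eq_subv_dim U W : (U <= W)%VS -> (\dim W <= \dim U)%N -> W = U.
Proof. by move=> UW dWU; apply/esym/eqP; rewrite eqEdim UW. Qed.

Lemma subv_codim1_eq U V W : (U <= W)%VS -> (W <= V)%VS ->
  (\dim V <= (\dim U).+1)%N -> ~~ (V <= W)%VS -> W = U.
Proof.
move=> UW WV dV VW; apply: eq_subv_dim => //.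
have := dimv_leqif_sup WV; rewrite (negPf VW) => -[le1 /eqP ne]; lia.
Qed.

Definition chain X := forall k l, (k <= l)%N -> (X k <= X l)%VS.

(* X / Y, with the maps X k / Y k -> X l / Y l for k <= l, is the interval module
   supported on i < k <= a. *)
Definition step (i a : nat) X Y :=
  [/\ forall k, (Y k <= X k)%VS,
      forall k, \dim (X k) = (\dim (Y k) + (i < k <= a))%N
    & ~~ (X i.+1 <= Y a)%VS].

(* m k l is the dimension of the kernel of X k / Y k -> X l / Y l. *)
Definition kerdim (m : nat -> nat -> nat) X Y :=
  (forall k, (Y k <= X k)%VS) /\
  (forall k l, (k <= l)%N -> \dim (X k :&: Y l) = (\dim (Y k) + m k l)%N).

(** The kernel is [(X k :&: Y l) / Y k]. For [k] in the support it is all or nothing: a nonzero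
    kernel with [l <= a] would give [X i.+1 <= X k <= Y l <= Y a]. *)
Lemma step_kerdim i a X Y : chain X -> chain Y -> step i a X Y ->
  kerdim (fun k l => nat_of_bool ((i < k <= a) && (a < l))%N) X Y.
Proof.
move=> cX cY [YX dXY nXY]; split=> // k l kl.
have dk := dXY k; have dl := dXY l.
have capE1 : (X k <= Y l)%VS -> \dim (X k :&: Y l) = \dim (X k).
  by move=> /capv_idPl ->.
case: (boolP (i < k <= a)%N) dk => [ika|nika] dk; last first.
  have -> : X k = Y k by apply: eq_subv_dim (YX k) _; rewrite dk addn0.
  rewrite (capv_idPl (cY _ _ kl)); lia.
case: (ltnP a l) => al.
  rewrite capE1; first by rewrite dk; lia.
  apply: subv_trans (cX _ _ kl) _; rewrite (eq_subv_dim (YX l)) //; lia.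
suff -> : (X k :&: Y l = Y k)%VS by lia.
apply: subv_codim1_eq (capvSl _ (Y l)) _ _.
- by rewrite subv_cap YX cY.
- by rewrite dk; lia.
apply: contra nXY; rewrite subv_cap subvv /= => XYl.
apply: subv_trans (subv_trans (cX _ k _) XYl) (cY _ _ al); lia.
Qed.

(** From [N] on the chains agree, so the kernel of the map to a far index is the whole quotient and
    its dimension is recovered. *)
Lemma kerdim_step N i a X Y : (i < a)%N -> (forall k, (N <= k)%N -> X k = Y k) ->
  chain X -> chain Y ->
  kerdim (fun k l => nat_of_bool ((i < k <= a) && (a < l))%N) X Y -> step i a X Y.
Proof.
move=> ia XYN cX cY [YX dXY]; split=> // [k|].
  have := dXY k (maxn N (maxn k a.+1)) ltac:(lia).
  rewrite -XYN ?leq_maxl // (capv_idPl (cX _ _ _)); lia.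
have dXi : \dim (X i.+1) = (\dim (Y i.+1) + 1)%N.
  have := dXY i.+1 (maxn N a.+1) ltac:(lia).
  rewrite -XYN ?leq_maxl // (capv_idPl (cX _ _ _)); lia.
apply/negP => /capv_idPl XYa; have := dXY i.+1 a ia.
rewrite XYa; lia.
Qed.

(* X / Y is the direct sum of two interval modules. *)
Definition two_kerdim i a j b :=
  kerdim (fun k l => ((i < k <= a) && (a < l)) + ((j < k <= b) && (b < l)))%N.

(* An extension of two interval modules splits, or its middle term is obtained by
   exchanging the right ends. *)
Lemma step_comp i a j b X Y Z : (i < a)%N -> (j < b)%N ->
  chain X -> chain Y -> chain Z -> step i a X Y -> step j b Y Z ->
  if [&& (i < j)%N, (j <= a)%N, (a < b)%N & ~~ (X i.+1 <= Z a.+1)%VS]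
  then two_kerdim i b j a X Z else two_kerdim i a j b X Z.
Proof.
move=> ia jb cX cY cZ sXY sYZ.
have [_ dXY] := step_kerdim cX cY sXY; have [_ dYZ] := step_kerdim cY cZ sYZ.
have [YX dX nXY] := sXY; have [ZY dY nYZ] := sYZ.
have ZX k : (Z k <= X k)%VS by apply: subv_trans (ZY k) (YX k).
have main k l : (k <= l)%N -> \dim (X k :&: Z l) = (\dim (Z k) +
   if [&& (i < j)%N, (j <= a)%N, (a < b)%N & ~~ (X i.+1 <= Z a.+1)%VS]
   then ((i < k <= b) && (b < l)) + ((j < k <= a) && (a < l))
   else ((i < k <= a) && (a < l)) + ((j < k <= b) && (b < l)))%N.
  move=> kl; have dXk := dX k; have dYk := dY k.
  (* When [X / Y] is injective from [k] to [l], only the kernel of the submodule [Y / Z] counts. *)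
  case: (boolP ((i < k <= a) && (a < l))%N) => [/andP[ika al]|nikal]; last first.
    have -> : (X k :&: Z l = Y k :&: Z l)%VS.
      have XYk : (X k :&: Y l = Y k)%VS.
        apply: eq_subv_dim; first by rewrite subv_cap YX cY.
        by rewrite dXY // (negPf nikal) addn0.
      by rewrite -XYk -capvA (capv_idPr (ZY l)).
    by rewrite dYZ //; case: ifP => c; lia.
  have XYl : (X k <= Y l)%VS.
    by apply/capv_idPl/eqP; rewrite eqEdim capvSl dXY //; lia.
  case: (boolP (j < l <= b)%N) => jlb; last first.
    have -> : Z l = Y l.
      by apply/esym; apply: eq_subv_dim (ZY l) _; rewrite (dY l); lia.
    by rewrite (capv_idPl XYl); case: ifP => c; lia.
  (* If [a < j], the index [a.+1] is outside both supports: [X], [Y], [Z] agree there and [X k]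
     falls into [Z l]. *)
  case: (ltnP a j) => aj.
    rewrite andbF; have XZ : (X k <= Z l)%VS.
      apply: (@subv_trans _ _ (X a.+1)); first by apply: cX; lia.
      have -> : X a.+1 = Z a.+1.
        have -> : X a.+1 = Y a.+1 by apply: eq_subv_dim (YX _) _; rewrite dX; lia.
        by apply: eq_subv_dim (ZY _) _; rewrite dY; lia.
      by apply: cZ; lia.
    rewrite (capv_idPl XZ); lia.
  have ab : (a < b)%N by lia.
  (* For [j < k] the quotient [X k / Z k] is a plane; its map to [X l / Z l] is nonzero with image
     in the line [Y l / Z l], so its kernel is a line. *)
  case: (ltnP j k) => jk.
    have nXZ : ~~ (X k <= Z l)%VS.
      apply: contra nYZ => XZ; have lb : (l <= b)%N by lia.
      by rewrite (subv_trans (YX _)) // (subv_trans (cX _ _ jk)) //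
        (subv_trans XZ) ?cZ.
    have lt1 : (\dim (X k :&: Z l) < \dim (X k))%N.
      rewrite (ltn_leqif (dimv_leqif_eq (capvSl _ _))).
      by apply: contra nXZ => /eqP/capv_idPl.
    have := dimv_sum_cap (X k) (Z l).
    have : (\dim (X k + Z l) <= \dim (Y l))%N by rewrite dimvS // subv_add XYl ZY.
    rewrite (dY l) jlb; case: ifP => c; lia.
  (* For [k <= j] the quotient [X k / Z k] is a line, the image of [X i.+1]. Whether it dies at
     [a.+1] distinguishes the two middle terms. *)
  have YZk : Y k = Z k by apply: eq_subv_dim (ZY k) _; lia.
  have XZk : (X k <= X i.+1 + Z k)%VS.
    apply: contraNT nXY => /(subv_codim1_eq (addvSr _ _)) -/(_ _ _) XiZ.
    have /addv_idPr : (X i.+1 + Z k)%VS = Z k.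
      by apply: XiZ; [rewrite subv_add ZX cX //; lia | lia].
    by move=> /subv_trans; apply; rewrite -YZk cY //; lia.
  case: ifP => [/and4P[ij _ _ nXZ]|c].
    suff -> : (X k :&: Z l = Z k)%VS by lia.
    apply: subv_codim1_eq (capvSl _ (Z l)) _ _.
    - by rewrite subv_cap ZX cZ.
    - by lia.
    (* Otherwise [X i.+1] would lie in [Y a.+1 :&: Z l], which is [Z a.+1] because [Y / Z] is
       injective from [a.+1] to [l <= b]. *)
    apply: contra nXZ; rewrite subv_cap subvv /= => XZl.
    have -> : Z a.+1 = (Y a.+1 :&: Z l)%VS.
      apply/esym/eq_subv_dim; first by rewrite subv_cap ZY cZ.
      by rewrite dYZ //; lia.
    have <- : X a.+1 = Y a.+1 by apply: eq_subv_dim (YX _) _; rewrite dX; lia.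
    by rewrite subv_cap (cX i.+1 a.+1) ?(subv_trans (cX i.+1 k _)) //; lia.
  have XZa : (X i.+1 <= Z a.+1)%VS by move: c; case: (X i.+1 <= _)%VS => //; lia.
  have /capv_idPl -> : (X k <= Z l)%VS.
    apply: subv_trans XZk _; rewrite subv_add (cZ k) // (subv_trans XZa) //.
    by apply: cZ.
  lia.
case: ifP main => _ main; split=> // k l kl; exact: main.
Qed.

End Chains.

(** * Lines in a two-dimensional quotient *)

Section Lines.
Variables (F : finFieldType) (vT : vectType F).
Implicit Types (U V W T : {vspace vT}) (X Y Z : nat -> {vspace vT}).

Lemma dim_add_line U (u : vT) : u \notin U -> \dim (U + <[u]>) = (\dim U).+1.
Proof.
move=> uU; have u0 : u != 0 by apply: contraNneq uU => ->; exact: mem0v.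
have := dimv_sum_cap U <[u]>; rewrite dim_vline u0.
suff -> : (U :&: <[u]>)%VS = 0%VS by rewrite dimv0 addn0 addn1.
apply/eqP; rewrite -subv0; apply/subvP => x; rewrite memv_cap memv0.
case/andP=> xU /vlineP[c xE]; move: xU; rewrite xE.
by rewrite rpredZeq (negPf uU) orbF => /eqP->; rewrite scale0r.
Qed.

Definition lines U V := [set W | [&& (U <= W)%VS, (W <= V)%VS & \dim W == (\dim U).+1]].

(** With [T = U + <[t]>] and [u] in [V] outside [T], the lines other than [T] are spanned by the
    vectors [u + c *: t], one for each scalar [c]. *)
Lemma card_linesD1 U V T : \dim V = (\dim U).+2 -> T \in lines U V ->
  #|lines U V :\ T| = #|F|.
Proof.
move=> dV; rewrite inE => /and3P[UT TV /eqP dT].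
have /subvPn[t tT tU] : ~~ (T <= U)%VS by apply/negP => /dimvS; lia.
have /subvPn[u uV uT] : ~~ (V <= T)%VS by apply/negP => /dimvS; lia.
have TE : T = (U + <[t]>)%VS.
  by apply: eq_subv_dim; rewrite ?subv_add ?UT // dim_add_line // dT.
pose f (c : F) := (U + <[u + c *: t]>)%VS.
have fT c : u + c *: t \notin T.
  by apply: contra uT => h; rewrite -(addrK (c *: t) u) rpredB ?memvZ.
have fU c : u + c *: t \notin U by apply: contra (fT c); exact: subvP.
have uf c : u + c *: t \in f c by rewrite (subvP (addvSr _ _)) ?memv_line.
have fL c : f c \in lines U V.
  rewrite inE addvSl subv_add (subv_trans UT TV) dim_add_line // eqxx andbT /=.
  by rewrite -memvE rpredD // memvZ // (subvP TV).
have fNT c : f c != T by apply: contraNneq (fT c) => <-.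
rewrite -cardsT -(@card_imset _ _ f) => [|c c' ffc].
  apply: eq_card => W; rewrite in_setD1; apply/andP/imsetP => [[WT]|[c _ ->]] //.
  rewrite inE => /and3P[UW WV /eqP dW].
  have WTV : V = (W + T)%VS.
    apply: eq_subv_dim; first by rewrite subv_add WV.
    rewrite dV -dW ltnNge; apply: contra WT => WTW.
    by rewrite eq_sym eqEdim dT dW leqnn andbT -(eq_subv_dim _ WTW) ?addvSl ?addvSr.
  (* Writing [u = w + x + c *: t] along [V = W + T] puts [u - c *: t] in [W]. *)
  move: uV; rewrite WTV TE => /memv_addP[w wW [t' /memv_addP[x xU [y /vlineP[c ->] ->]] uE]].
  exists (- c) => //; apply: eq_subv_dim; last by rewrite dim_add_line ?dW.
  rewrite subv_add UW -memvE uE scaleNr addrA addrK rpredD //.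
  exact: subvP UW _ xU.
(* Injectivity: if [f c = f c'] with distinct scalars, subtracting the generators puts [t] in [f c],
   so [f c = T]. *)
apply/eqP; apply: contraNT (fNT c) => cc'.
have tf : t \in f c.
  have : (c - c') *: t \in f c.
    rewrite scalerBl -(addrKA u) [c *: t + u]addrC [u + c' *: t]addrC.
    by rewrite [c' *: t + u]addrC rpredB // ffc.
  by rewrite rpredZeq subr_eq0 (negPf cc').
have : T = f c; last by move=> ->.
apply/esym/eq_subv_dim; first by rewrite TE subv_add addvSl -memvE.
by rewrite dim_add_line // dT.
Qed.

Lemma card_lines U V : \dim V = (\dim U).+2 -> (U <= V)%VS ->
  #|lines U V| = #|F|.+1.
Proof.
move=> dV UV.
have /subvPn[t tV tU] : ~~ (V <= U)%VS by apply/negP => /dimvS; lia.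
have TL : (U + <[t]>)%VS \in lines U V.
  by rewrite inE addvSl subv_add UV -memvE tV dim_add_line ?eqxx.
by rewrite (cardsD1 (U + <[t]>)%VS) TL (card_linesD1 dV TL).
Qed.

Lemma card_linesD2 U V T S : \dim V = (\dim U).+2 ->
  T \in lines U V -> S \in lines U V -> S != T ->
  #|lines U V :\ T :\ S| = #|F|.-1.
Proof.
move=> dV TL SL ST; have := card_linesD1 dV TL.
by rewrite (cardsD1 S) in_setD1 ST SL /= => <-.
Qed.

End Lines.

(** * Intermediate chains as lines in a quotient *)

Section Middle.
Variables (F : finFieldType) (vT : vectType F).
Implicit Types (S U V W T : {vspace vT}) (X Y Z : nat -> {vspace vT}).

(* The conditions on W = Y j.+1 for X >= Y >= Z with step i a X Y and step j b Y Z;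
   mid_chain recovers Y from W. *)
Definition mid_pred i a j b X Z W :=
  [&& W \in lines (Z j.+1) (X j.+1), (W <= Z b.+1)%VS, ~~ (W <= Z b)%VS
    & ~~ (X i.+1 <= if (a <= j)%N then Z a else (Z a + W)%VS)%VS].

(** An interval module [(j, b]] is generated by its first nonzero step, so the later steps are
    [Z k + W]; past [b] this is [Z k] again, as [W <= Z b.+1]. *)
Definition mid_chain j Z W k := if (k <= j)%N then Z k else (Z k + W)%VS.

Definition two_dims i a j b X Z :=
  forall k, \dim (X k) = (\dim (Z k) + (i < k <= a) + (j < k <= b))%N.

Lemma steps_mid_pred i a j b X Y Z : (i < a)%N -> (j < b)%N ->
  chain Y -> chain Z -> step i a X Y -> step j b Y Z ->
  (forall k, Y k = mid_chain j Z (Y j.+1) k) /\ mid_pred i a j b X Z (Y j.+1).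
Proof.
move=> ia jb cY cZ [YX dX nXY] [ZY dY nYZ].
have YE k : Y k = mid_chain j Z (Y j.+1) k.
  rewrite /mid_chain; case: leqP => kj.
    by apply: eq_subv_dim (ZY k) _; rewrite dY; lia.
  have sY : (Z k + Y j.+1 <= Y k)%VS by rewrite subv_add ZY cY.
  apply: eq_subv_dim sY _; rewrite (dY k).
  case: (leqP k b) => kb; last first.
    by rewrite andbF addn0 dimvS // addvSl.
  rewrite kj addn1 (ltn_leqif (dimv_leqif_sup (addvSl (Z k) (Y j.+1)))).
  rewrite subv_add subvv /=; apply: contra nYZ => YZk.
  exact: subv_trans YZk (cZ _ _ kb).
split=> //; rewrite /mid_pred inE ZY YX dY ltnSn jb addn1 eqxx nYZ /=.
have -> : (Y j.+1 <= Z b.+1)%VS.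
  have <- : Y b.+1 = Z b.+1 by apply: eq_subv_dim (ZY _) _; rewrite dY; lia.
  by apply: cY; lia.
by move: nXY; rewrite {1}YE.
Qed.

(** The conditions at [Z b.+1] and [Z b] make the submodule the interval [(j, b]]; the last
    condition keeps [X i.+1] alive at [a] in the quotient. *)
Lemma mid_pred_steps i a j b X Z W : (i < a)%N -> (j < b)%N ->
  chain X -> chain Z -> (forall k, Z k <= X k)%VS -> two_dims i a j b X Z ->
  mid_pred i a j b X Z W ->
  [/\ chain (mid_chain j Z W), step i a X (mid_chain j Z W)
    & step j b (mid_chain j Z W) Z].
Proof.
move=> ia jb cX cZ ZX dXZ; rewrite /mid_pred inE.
move=> /and4P[/and3P[ZW WX /eqP dW] WZ nWZ nXZ].
have ZY k : (Z k <= mid_chain j Z W k)%VS.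
  by rewrite /mid_chain; case: ifP => // _; exact: addvSl.
have dY k : \dim (mid_chain j Z W k) = (\dim (Z k) + (j < k <= b))%N.
  rewrite /mid_chain; case: leqP => kj; first by rewrite addn0.
  case: leqP => kb; last first.
    by rewrite (addv_idPl (subv_trans WZ (cZ _ _ kb))) addn0.
  rewrite /= addn1; apply/eqP; rewrite eqn_leq; apply/andP; split.
    (* [W / Z j.+1] is a line and [Z j.+1 <= Z k], so adding [W] raises the dimension by at most
       one. *)
    have := dimv_sum_cap (Z k) W; have : (Z j.+1 <= Z k :&: W)%VS.
      by rewrite subv_cap ZW cZ.
    move=> /dimvS; lia.
  rewrite (ltn_leqif (dimv_leqif_sup (addvSl (Z k) W))) subv_add subvv /=.
  by apply: contra nWZ => WZk; exact: subv_trans WZk (cZ _ _ kb).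
have cY : chain (mid_chain j Z W).
  move=> k l kl; rewrite {1}/mid_chain; case: leqP => kj.
    exact: subv_trans (cZ _ _ kl) (ZY l).
  by rewrite /mid_chain leqNgt (leq_trans kj kl) /= addvS ?cZ.
split=> //.
  split=> // k; last by rewrite dXZ dY; lia.
  rewrite /mid_chain; case: leqP => kj //; rewrite subv_add ZX.
  exact: subv_trans WX (cX _ _ kj).
by split=> //; rewrite /mid_chain ltnn (addv_idPr ZW).
Qed.

Lemma two_kerdim_dims N i a j b X Z : chain X -> (forall k, (N <= k)%N -> X k = Z k) ->
  two_kerdim i a j b X Z -> two_dims i a j b X Z.
Proof.
move=> cX XZ [_ d] k; have := d k (k + a + b + N).+1 ltac:(lia).
rewrite -XZ ?(capv_idPl (cX _ _ _)); lia.
Qed.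

(* Number of submodules N = (j, b] of M with M / N = (i, a] over the field with q
   elements: M = (i, a] + (j, b] in hall1, M = (i, b] + (j, a] in hall2. *)
Definition hall1 (q i a j b : nat) : nat :=
  if [&& i == j, a == b & (i < a)%N] then q.+1
  else if (i <= j < a)%N && (a <= b)%N then q else 1.

Definition hall2 (q a j : nat) : nat := if j == a then 1 else q.-1.

(** The index [j.+1] is outside [(i, a]], so [X j.+1 / Z j.+1] is itself a line and [W = X j.+1] is
    the only candidate. *)
Lemma card_mid_small i a j b X Z : chain X -> chain Z -> (i < a)%N -> (j < b)%N ->
  (a <= j)%N || (j < i)%N -> two_dims i a j b X Z -> two_kerdim i a j b X Z ->
  #|[set W | mid_pred i a j b X Z W]| = 1%N.
Proof.
move=> cX cZ ia jb ajji dXZ [ZX d].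
rewrite -(cards1 (X j.+1)); apply: eq_card => W.
have dj := dXZ j.+1.
rewrite !inE /mid_pred inE; apply/idP/eqP => [/and4P[/and3P[ZW WX /eqP dW] _ _ _]|->].
  by apply/esym/eq_subv_dim => //; lia.
rewrite ZX subvv dj; apply/and4P; split; first by apply/eqP; lia.
- apply/capv_idPl/eqP; rewrite eqEdim capvSl d; lia.
- apply/negP => /capv_idPl XZ; have := d j.+1 b jb; rewrite XZ; lia.
apply/negP; case: leqP => [aj /capv_idPl XZ|ja sub].
  have := d i.+1 a ia; rewrite XZ (dXZ i.+1); lia.
(* The rank of the map to step [a] is larger by one from step [i.+1] than from step [j.+1], where
   [(i, a]] is absent. *)
have : (X i.+1 + Z a <= Z a + X j.+1)%VS by rewrite subv_add sub addvSl.
move/dimvS; have := dimv_sum_cap (X i.+1) (Z a); have := dimv_sum_cap (Z a) (X j.+1).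
rewrite (capvC (Z a)) (d i.+1 a ia) (d j.+1 a ja) (dXZ i.+1) dj; lia.
Qed.

(** With [j = a] the interval [(j, a]] is empty: the middle term is the single interval [(i, b]],
    one-dimensional at [a.+1]. *)
Lemma card_mid_small2 i a b X Z : chain X -> chain Z -> (i < a < b)%N ->
  two_dims i a a b X Z -> two_kerdim i b a a X Z ->
  #|[set W | mid_pred i a a b X Z W]| = 1%N.
Proof.
move=> cX cZ iab dXZ [ZX d].
rewrite -(cards1 (X a.+1)); apply: eq_card => W.
have dj := dXZ a.+1.
rewrite !inE /mid_pred inE; apply/idP/eqP => [/and4P[/and3P[ZW WX /eqP dW] _ _ _]|->].
  by apply/esym/eq_subv_dim => //; lia.
rewrite ZX subvv dj; apply/and4P; split; first by apply/eqP; lia.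
- apply/capv_idPl/eqP; rewrite eqEdim capvSl d; lia.
- apply/negP => /capv_idPl XZ; have := d a.+1 b ltac:(lia); rewrite XZ; lia.
rewrite leqnn; apply/negP => /capv_idPl XZ; have := d i.+1 a ltac:(lia).
rewrite XZ (dXZ i.+1); lia.
Qed.

(** Modular law: inside [V], the sum [U + W] reduces to [(U :&: V) + W = W]. *)
Lemma subv_addl_mod S U V W : (W <= V)%VS -> (U :&: V <= W)%VS ->
  (S <= V)%VS -> (S <= U + W)%VS = (S <= W)%VS.
Proof.
move=> WV UVW SV; apply/idP/idP => [sub|/subv_trans]; last by apply; exact: addvSr.
apply/subvP => x xX; have /memv_addP[u uU [w wW xE]] := subvP sub x xX.
have uV : u \in V.
  by rewrite -(addrK w u) -xE rpredB //; [exact: subvP SV _ xX | exact: subvP WV _ wW].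
by rewrite xE rpredD // (subvP UVW) // memv_cap uU.
Qed.

(** [W] must die at [b.+1], where [(i, a]] is still alive; this kernel [W0] is already a line modulo
    [Z j.+1]. *)
Lemma card_mid_lt i a j b X Z : chain X -> chain Z -> (i <= j)%N -> (j < b < a)%N ->
  two_dims i a j b X Z -> two_kerdim i a j b X Z ->
  #|[set W | mid_pred i a j b X Z W]| = 1%N.
Proof.
move=> cX cZ ij jba dXZ [ZX d].
set W0 := (X j.+1 :&: Z b.+1)%VS.
have dj := dXZ j.+1; have dW0 : \dim W0 = (\dim (Z j.+1)).+1 by rewrite d; lia.
rewrite -(cards1 W0); apply: eq_card => W.
rewrite !inE /mid_pred inE.
apply/idP/eqP => [/and4P[/and3P[ZW WX /eqP dW] WZ _ _]|->].
  by apply/esym/eq_subv_dim; rewrite ?subv_cap ?WX ?dW0 ?dW.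
have ZW0 : (Z j.+1 <= W0)%VS by rewrite subv_cap ZX cZ //; lia.
rewrite ZW0 (capvSl (X j.+1) _ : W0 <= _)%VS (capvSr _ (Z b.+1) : W0 <= _)%VS.
rewrite dW0 eqxx /=; apply/andP; split.
  apply/negP => W0Z; have := d j.+1 b ltac:(lia).
  have : (W0 <= X j.+1 :&: Z b)%VS by rewrite subv_cap capvSl W0Z.
  move/dimvS; lia.
rewrite leqNgt (_ : (j < a)%N) /=; last by lia.
have /addv_idPl -> : (W0 <= Z a)%VS.
  by apply: subv_trans (capvSr _ _) (cZ _ _ _); lia.
apply/negP => /capv_idPl XZ; have := d i.+1 a ltac:(lia).
rewrite XZ (dXZ i.+1); lia.
Qed.

(* For [i <= j < a <= b] the line [W] in the plane [X j.+1 / Z j.+1] has to avoid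
   the images of [X j.+1 :&: Z b] and of [X i.+1]. *)
Lemma mid_pred_ge i a j b X Z W : chain X -> chain Z -> (i <= j < a)%N -> (a <= b)%N ->
  (X j.+1 :&: Z a <= Z j.+1)%VS -> (X j.+1 <= Z b.+1)%VS ->
  mid_pred i a j b X Z W =
  [&& W \in lines (Z j.+1) (X j.+1),
      ~~ (W <= X j.+1 :&: Z b)%VS & ~~ (X i.+1 + Z j.+1 <= W)%VS].
Proof.
move=> cX cZ ija ab XZa XZb; rewrite /mid_pred !inE subv_cap.
case: (boolP (Z j.+1 <= W)%VS) => //= ZW; case: (boolP (W <= X j.+1)%VS) => //= WX.
rewrite (subv_trans WX XZb) leqNgt (_ : (j < a)%N) /=; last by lia.
rewrite (@subv_addl_mod _ _ (X j.+1)) //.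
- by rewrite subv_add ZW andbT.
- by rewrite capvC (subv_trans XZa).
- by apply: cX; lia.
Qed.

End Middle.

(** * Hall numbers of two interval modules *)

Section Planes.
Variables (F : finFieldType) (vT : vectType F).
Implicit Types (S U V W T : {vspace vT}) (X Y Z : nat -> {vspace vT}).

(** The first condition excludes only [W = T] and the second only [W = S]; each counts only if it is
    a line modulo [U], and once if [S = T]. *)
Lemma card_lines_avoid U V T S : \dim V = (\dim U).+2 ->
  (U <= T <= V)%VS -> (U <= S <= V)%VS ->
  (\dim U <= \dim T <= (\dim U).+1)%N -> (\dim U < \dim S <= (\dim U).+2)%N ->
  #|[set W | [&& W \in lines U V, ~~ (W <= T)%VS & ~~ (S <= W)%VS]]| =
  if \dim T == \dim U
  then if \dim S == (\dim U).+2 then #|F|.+1 else #|F|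
  else if (\dim S == (\dim U).+2) || (S == T) then #|F| else #|F|.-1.
Proof.
move=> dV /andP[UT TV] /andP[US SV] dT dS.
have inT : (T \in lines U V) = (\dim T != \dim U).
  by rewrite inE UT TV /=; lia.
have inS : (S \in lines U V) = (\dim S != (\dim U).+2).
  by rewrite inE US SV /=; lia.
have WT W : W \in lines U V -> (W <= T)%VS = (W == T).
  rewrite inE => /and3P[_ _ /eqP dW]; apply/idP/eqP => [WT|->] //.
  by apply/esym/eq_subv_dim; rewrite // dW; lia.
have SW W : W \in lines U V -> (S <= W)%VS = (W == S).
  rewrite inE => /and3P[_ _ /eqP dW]; apply/idP/eqP => [SW|->] //.
  by apply: eq_subv_dim; rewrite // dW; lia.
have -> : [set W | [&& W \in lines U V, ~~ (W <= T)%VS & ~~ (S <= W)%VS]] =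
    lines U V :\ T :\ S.
  apply/setP => W; rewrite finset.in_set !in_setD1.
  case: (boolP (W \in lines U V)) => [L|_]; last by rewrite !andbF.
  by rewrite (WT _ L) (SW _ L) /= andbT [RHS]andbC.
have rm (A : {set {vspace vT}}) W : W \notin A -> A :\ W = A.
  by move=> WA; apply/setP => x; rewrite in_setD1; case: eqP => // ->; rewrite (negPf WA).
have UV := subv_trans UT TV.
case: (eqVneq (\dim T) (\dim U)) inT => [_ /negbT nT|_ T1].
  rewrite (rm _ _ nT); case: (eqVneq (\dim S) _) inS => [_ /negbT nS|_ S1].
    by rewrite rm ?card_lines.
  by rewrite (card_linesD1 dV S1).
case: (eqVneq S T) => [->|ST].
  by rewrite orbT rm ?in_setD1 ?eqxx // (card_linesD1 dV T1).
rewrite orbF; case: (eqVneq (\dim S) _) inS => [_ /negbT nS|_ S1].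
  by rewrite rm ?(card_linesD1 dV T1) // in_setD1 negb_and nS orbT.
exact: card_linesD2.
Qed.

(** The kernel at [b] is zero when [a = b], and the image of [X i.+1] is the whole plane when
    [i = j]. Each is a line otherwise, and two such lines coincide, since [(i, a]] dies at
    [a.+1 <= b]. *)
Lemma card_mid_ge i a j b X Z : chain X -> chain Z -> (i <= j < a)%N -> (a <= b)%N ->
  two_dims i a j b X Z -> two_kerdim i a j b X Z ->
  #|[set W | mid_pred i a j b X Z W]| = hall1 #|F| i a j b.
Proof.
move=> cX cZ ija ab dXZ [ZX d].
have dj : \dim (X j.+1) = (\dim (Z j.+1)).+2 by rewrite dXZ; lia.
have XZb : (X j.+1 <= Z b.+1)%VS.
  by apply/capv_idPl/eqP; rewrite eqEdim capvSl d; lia.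
have XZa : (X j.+1 :&: Z a <= Z j.+1)%VS.
  rewrite (@eq_subv_dim _ _ (Z j.+1) (X j.+1 :&: Z a)%VS) //; last by rewrite d; lia.
  by rewrite subv_cap ZX cZ //; lia.
have -> : [set W | mid_pred i a j b X Z W] = [set W | [&& W \in lines (Z j.+1) (X j.+1),
    ~~ (W <= X j.+1 :&: Z b)%VS & ~~ (X i.+1 + Z j.+1 <= W)%VS]].
  apply/setP => W; rewrite [LHS]finset.in_set [RHS]finset.in_set.
  by rewrite (mid_pred_ge _ cX cZ ija ab XZa XZb).
have dT : \dim (X j.+1 :&: Z b) = (\dim (Z j.+1) + (a < b))%N by rewrite d; lia.
have dS : \dim (X i.+1 + Z j.+1) = ((\dim (Z j.+1)).+1 + (i == j))%N.
  have := dimv_sum_cap (X i.+1) (Z j.+1); rewrite d ?dXZ; lia.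
have := @card_lines_avoid (Z j.+1) (X j.+1) (X j.+1 :&: Z b)%VS (X i.+1 + Z j.+1)%VS dj.
have -> : (Z j.+1 <= X j.+1 :&: Z b <= X j.+1)%VS.
  by rewrite subv_cap ZX cZ ?capvSl //; lia.
have -> : (Z j.+1 <= X i.+1 + Z j.+1 <= X j.+1)%VS.
  by rewrite addvSr subv_add ZX cX //; lia.
rewrite dT dS => -> //; try lia.
have ST : (i < j)%N -> (a < b)%N -> (X i.+1 + Z j.+1 = X j.+1 :&: Z b)%VS.
  move=> ij ab'; apply/esym/eq_subv_dim; last by rewrite dT dS; lia.
  rewrite subv_add !subv_cap cX ?ZX ?cZ ?andbT //=; try lia.
  apply: subv_trans (cZ a.+1 b ab'); apply/capv_idPl/eqP.
  by rewrite eqEdim capvSl d ?dXZ; lia.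
have -> : ((\dim (Z j.+1) + (a < b))%N == \dim (Z j.+1)) = (a == b) by lia.
have -> : (((\dim (Z j.+1)).+1 + (i == j))%N == (\dim (Z j.+1)).+2) = (i == j) by lia.
rewrite /hall1 ija ab /=; case: (eqVneq i j) => [ij|nij]; case: (eqVneq a b) => //= nab.
  by rewrite ifT //; lia.
by rewrite ST ?eqxx //; lia.
Qed.

(** Now the image of [X i.+1] survives up to [b], so it differs from the kernel at [b] and two lines
    are excluded. *)
Lemma card_mid_ge2 i a j b X Z : chain X -> chain Z -> (i < j < a)%N -> (a < b)%N ->
  two_dims i a j b X Z -> two_kerdim i b j a X Z ->
  #|[set W | mid_pred i a j b X Z W]| = #|F|.-1.
Proof.
move=> cX cZ ija ab dXZ [ZX d].
have dj : \dim (X j.+1) = (\dim (Z j.+1)).+2 by rewrite dXZ; lia.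
have XZb : (X j.+1 <= Z b.+1)%VS.
  by apply/capv_idPl/eqP; rewrite eqEdim capvSl d; lia.
have XZa : (X j.+1 :&: Z a <= Z j.+1)%VS.
  rewrite (@eq_subv_dim _ _ (Z j.+1) (X j.+1 :&: Z a)%VS) //; last by rewrite d; lia.
  by rewrite subv_cap ZX cZ //; lia.
have ija' : (i <= j < a)%N by lia.
have -> : [set W | mid_pred i a j b X Z W] = [set W | [&& W \in lines (Z j.+1) (X j.+1),
    ~~ (W <= X j.+1 :&: Z b)%VS & ~~ (X i.+1 + Z j.+1 <= W)%VS]].
  apply/setP => W; rewrite [LHS]finset.in_set [RHS]finset.in_set.
  by rewrite (mid_pred_ge _ cX cZ ija' (ltnW ab) XZa XZb).
have dT : \dim (X j.+1 :&: Z b) = (\dim (Z j.+1)).+1 by rewrite d; lia.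
have dS : \dim (X i.+1 + Z j.+1) = (\dim (Z j.+1)).+1.
  have := dimv_sum_cap (X i.+1) (Z j.+1); rewrite d ?dXZ; lia.
have := @card_lines_avoid (Z j.+1) (X j.+1) (X j.+1 :&: Z b)%VS (X i.+1 + Z j.+1)%VS dj.
have -> : (Z j.+1 <= X j.+1 :&: Z b <= X j.+1)%VS.
  by rewrite subv_cap ZX cZ ?capvSl //; lia.
have -> : (Z j.+1 <= X i.+1 + Z j.+1 <= X j.+1)%VS.
  by rewrite addvSr subv_add ZX cX //; lia.
rewrite dT dS => -> //; try lia.
rewrite ifF ?ifF //; last by lia.
rewrite (_ : (_ == _.+2) = false) /=; last by lia.
apply/negP => /eqP ST; have : (X i.+1 <= Z b)%VS.
  by rewrite (subv_trans (addvSl _ (Z j.+1))) // ST capvSr.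
move/capv_idPl => XZ; have := d i.+1 b ltac:(lia); rewrite XZ dXZ; lia.
Qed.

Lemma card_mid1 i a j b X Z : chain X -> chain Z -> (i < a)%N -> (j < b)%N ->
  two_dims i a j b X Z -> two_kerdim i a j b X Z ->
  #|[set W | mid_pred i a j b X Z W]| = hall1 #|F| i a j b.
Proof.
move=> cX cZ ia jb dXZ kXZ; case: (boolP ((a <= j) || (j < i))%N) => h.
  by rewrite card_mid_small // /hall1 !ifF //; lia.
case: (leqP a b) => ab; first by apply: card_mid_ge => //; lia.
rewrite card_mid_lt // ?/hall1 ?ifF ?ifF //; lia.
Qed.

Lemma card_mid2 i a j b X Z : chain X -> chain Z -> (i < j <= a)%N -> (a < b)%N ->
  (j < b)%N ->
  two_dims i a j b X Z -> two_kerdim i b j a X Z ->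
  #|[set W | mid_pred i a j b X Z W]| = hall2 #|F| a j.
Proof.
move=> cX cZ ija ab jb dXZ kXZ; rewrite /hall2; case: (eqVneq j a) => ja.
  by move: ija ab dXZ kXZ; rewrite ja => ija ab; apply: card_mid_small2 => //; lia.
by apply: card_mid_ge2 => //; lia.
Qed.

End Planes.

(** * Relative position of flags *)

Section Flags.
Variables (F : finFieldType) (n d : nat).
Implicit Types (V : flag F n d) (C U : 'M[int]_n) (nu : 'rV[int]_n).

(** Capping the index at [n] turns a flag into a chain on [nat], equal to the whole space from [n]
    on. *)
Definition fl V (k : nat) : {vspace 'rV[F]_d} := val V (inord (minn k n)).

Lemma fl_widen V (i : 'I_n) : val V (widen_ord (leqnSn n) i) = fl V i.
Proof.
congr (val V _); apply: val_inj; rewrite /= inordK (minn_idPl (ltnW (ltn_ord i))) //.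
exact: leqW.
Qed.

Lemma fl_lift V (i : 'I_n) : val V (lift ord0 i) = fl V i.+1.
Proof.
congr (val V _); apply: val_inj; rewrite /= (minn_idPl (ltn_ord i)) inordK //.
by rewrite ltnS.
Qed.

Lemma fl_ge V k : (n <= k)%N -> fl V k = fullv.
Proof.
move=> nk; have /and3P[_ /eqP <- _] := valP V.
congr (val V _); apply: val_inj; rewrite /= (minn_idPr nk) inordK //.
Qed.

Lemma fl0 V : fl V 0 = 0%VS.
Proof.
have /and3P[/eqP <- _ _] := valP V.
by congr (val V _); apply: val_inj; rewrite /= min0n inordK.
Qed.

Lemma fl_chain V : chain (fl V).
Proof.
move=> k l; elim: l => [|l IH]; first by rewrite leqn0 => /eqP->.
rewrite leq_eqVlt => /predU1P[->//|]; rewrite ltnS => /IH /subv_trans; apply.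
case: (ltnP l n) => ln; last by rewrite [fl V l.+1]fl_ge ?subvf ?leqW.
have /and3P[_ _ /forallP/(_ (Ordinal ln))] := valP V.
by rewrite fl_widen fl_lift.
Qed.

Lemma fl_inj V V' : (forall k, fl V k = fl V' k) -> V = V'.
Proof.
move=> eqV; apply: val_inj; apply/ffunP => k; have := eqV k.
by rewrite /fl (minn_idPl (leq_ord k)) inord_val.
Qed.

Lemma flag_of_chain (X : nat -> {vspace 'rV[F]_d}) :
  chain X -> X 0%N = 0%VS -> (forall k, (n <= k)%N -> X k = fullv) ->
  exists V, forall k, fl V k = X k.
Proof.
move=> cX X0 Xn; pose f := [ffun k : 'I_n.+1 => X k].
have fP : is_flag f.
  apply/and3P; split; rewrite ?ffunE ?X0 ?Xn //.
  by apply/forallP => i; rewrite !ffunE; apply: cX.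
exists (exist _ f fP) => k; rewrite /fl /= ffunE inordK ?ltnS ?geq_minr //.
by case: (leqP n k) => // nk; rewrite !Xn.
Qed.

(** For the matrix of two flags these corner sums are the dimensions of the intersections; see
    [relpos_cum]. *)
Definition cum C k l : int := \sum_(i < n | (i < k)%N) \sum_(j < n | (j < l)%N) C i j.

Definition pre nu k : int := \sum_(i < n | (i < k)%N) nu 0 i.

Lemma sum_ord_ltS (G : 'I_n -> int) (i : 'I_n) :
  \sum_(k < n | (k < i.+1)%N) G k = \sum_(k < n | (k < i)%N) G k + G i.
Proof.
rewrite (bigD1 i) //= addrC; congr (_ + _); apply: eq_bigl => k.
by rewrite ltnS ltn_neqAle andbC.
Qed.

Lemma telescope_ord (f : nat -> int) l :
  \sum_(j < n | (j < l)%N) (f j.+1 - f j) = f (minn l n) - f 0%N.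
Proof.
rewrite -(telescope_sumr _ (leq0n _)) big_mkord.
rewrite (big_ord_widen n (fun j => f j.+1 - f j)) ?geq_minr //.
by apply: eq_bigl => j; rewrite leq_min ltn_ord andbT.
Qed.

Lemma entry_cum C i j :
  C i j = cum C i.+1 j.+1 - cum C i j.+1 - (cum C i.+1 j - cum C i j).
Proof.
by rewrite /cum !sum_ord_ltS; ring.
Qed.

(** The dimension formula for a sum of subspaces turns the entry into a mixed second difference. *)
Lemma relposE V V' i j : relpos V V' i j =
  (\dim (fl V i.+1 :&: fl V' j.+1))%:Z - (\dim (fl V i :&: fl V' j.+1))%:Z
  - ((\dim (fl V i.+1 :&: fl V' j))%:Z - (\dim (fl V i :&: fl V' j))%:Z).
Proof.
have dimE l : \dim (fl V i + (fl V i.+1 :&: fl V' l)) + \dim (fl V i :&: fl V' l) =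
    (\dim (fl V i) + \dim (fl V i.+1 :&: fl V' l))%N.
  have <- := dimv_sum_cap (fl V i) (fl V i.+1 :&: fl V' l).
  by rewrite capvA (capv_idPl (fl_chain V (leqnSn i))).
have le : (\dim (fl V i + (fl V i.+1 :&: fl V' j)) <=
           \dim (fl V i + (fl V i.+1 :&: fl V' j.+1)))%N.
  by rewrite dimvS // addvS // capvS // fl_chain.
rewrite mxE /= !fl_widen !fl_lift; have := dimE j; have := dimE j.+1; lia.
Qed.

(** Second differences telescope to corner sums; the boundary terms vanish because flags start at
    zero. *)
Lemma relpos_cum V V' C :
  relpos V V' = C <-> forall k l, (\dim (fl V k :&: fl V' l))%:Z = cum C k l.
Proof.
split=> [<- k l|h]; last by apply/matrixP => i j; rewrite relposE !h -entry_cum.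
pose r k l : int := (\dim (fl V k :&: fl V' l))%:Z.
have fmin (V0 : flag F n d) k0 : fl V0 (minn k0 n) = fl V0 k0.
  by case: (leqP n k0) => // nk; rewrite !fl_ge.
pose f k := r k l - r k 0%N.
rewrite /cum; under eq_bigr => i _ do under eq_bigr => j _ do rewrite relposE.
under eq_bigr => i _.
  rewrite (telescope_ord (fun j => r i.+1 j - r i j)) /r !fl0 !capv0 dimv0 !fmin.
  over.
rewrite /= subrr.
under eq_bigr => i _ do rewrite subr0.
by rewrite (telescope_ord (fun i => r i l)) /r fl0 fmin cap0v dimv0 subr0.
Qed.

Lemma cumD C C' k l : cum (C + C') k l = cum C k l + cum C' k l.
Proof.
rewrite /cum -big_split; apply: eq_bigr => i _; rewrite -big_split.
by apply: eq_bigr => j _; rewrite mxE.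
Qed.

Lemma cum_delta i a k l : cum (delta_mx i a) k l = ((i < k) && (a < l))%N%:R.
Proof.
rewrite /cum; under eq_bigr => i' _ do under eq_bigr => j _ do rewrite mxE.
case: (ltnP i k) => ik; last first.
  rewrite big1 // => i' i'k; rewrite big1 // => j _.
  by case: eqP => // ii'; move: i'k; rewrite ii' ltnNge ik.
rewrite (bigD1 i) //= [X in _ + X]big1 ?addr0 => [|i' /andP[_ /negPf ii']]; last first.
  by rewrite big1 // => j _; rewrite ii'.
case: (ltnP a l) => al; last first.
  rewrite big1 // => j jl; rewrite eqxx /=.
  by case: eqP => // ja; move: jl; rewrite ja ltnNge al.
rewrite (bigD1 a) //= big1 ?addr0 ?eqxx // => j /andP[_ /negPf ja].
by rewrite ja.
Qed.

Lemma cum_diag nu k l : cum (diag_mx nu) k l = pre nu (minn k l).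
Proof.
rewrite /cum /pre [RHS]big_mkcond [LHS]big_mkcond; apply: eq_bigr => i _.
rewrite leq_min; case: ltnP => //= ik; rewrite big_mkcond (bigD1 i) //= big1 => [|j ji].
  by rewrite mxE eqxx addr0 mulr1n.
by rewrite mxE eq_sym (negPf ji) mulr0n if_same.
Qed.

Lemma preD nu nu' k : pre (nu + nu') k = pre nu k + pre nu' k.
Proof. by rewrite /pre -big_split; apply: eq_bigr => i _; rewrite mxE. Qed.

Lemma pre_delta i k : pre (delta_mx 0 i) k = (i < k)%N%:R.
Proof.
rewrite /pre; case: (ltnP i k) => ik.
  rewrite (bigD1 i) //= mxE !eqxx big1 ?addr0 // => j /andP[_ /negPf ji].
  by rewrite mxE ji andbF.
rewrite big1 // => j jk; rewrite mxE eqxx; case: eqP => //= ji.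
by move: jk; rewrite ji ltnNge ik.
Qed.

Lemma relpos_kerdim V V' U nu m :
  (forall k l, (l <= k)%N -> cum U k l = cum U l l) ->
  (forall k l, (k <= l)%N -> cum U k l = cum U k k + (m k l)%:Z) ->
  relpos V V' = U + diag_mx nu <->
  kerdim m (fl V) (fl V') /\ forall k, (\dim (fl V' k))%:Z = cum U k k + pre nu k.
Proof.
move=> Ul Uk; rewrite relpos_cum; split=> [h|[[VV' h] dV'] k l].
  have dV' k : (\dim (fl V' k))%:Z = cum U k k + pre nu k.
    (* At an index from [n] on, [V] is the whole space and the intersection is all of [fl V' k]. *)
    have := h (maxn n k) k; rewrite fl_ge ?leq_maxl // capfv => ->.
    by rewrite cumD cum_diag Ul ?leq_maxr // (minn_idPr (leq_maxr _ _)).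
  split=> //; split=> [k|k l kl].
    suff : (fl V k :&: fl V' k = fl V' k)%VS by move/capv_idPr.
    apply/eqP; rewrite eqEdim capvSr /= -lez_nat h dV' cumD cum_diag minnn //.
  apply/eqP; rewrite -eqz_nat PoszD dV' h cumD cum_diag (minn_idPl kl) (Uk _ _ kl).
  by rewrite addrAC.
rewrite cumD cum_diag; case: (leqP k l) => [kl|/ltnW lk].
  by rewrite h // PoszD dV' (Uk _ _ kl) addrAC.
rewrite Ul // -dV' (capv_idPr (subv_trans (VV' l) _)) //; exact: fl_chain.
Qed.

Lemma relpos_single V V' (i a : 'I_n) nu : (i <= a)%N ->
  relpos V V' = delta_mx i a + diag_mx nu <->
  kerdim (fun k l => nat_of_bool ((i < k <= a) && (a < l))%N) (fl V) (fl V') /\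
  forall k, (\dim (fl V' k))%:Z = pre nu k + (a < k)%N%:R.
Proof.
move=> ia; rewrite (@relpos_kerdim _ _ _ _
  (fun k l => nat_of_bool ((i < k <= a) && (a < l))%N)) => [|k l kl|k l kl].
- split=> -[h1 h2]; split=> // k; rewrite h2 cum_delta; lia.
- by rewrite !cum_delta; lia.
- rewrite !cum_delta; lia.
Qed.

Lemma relpos_double V V' (i a j b : 'I_n) nu : (i <= a)%N -> (j <= b)%N ->
  relpos V V' = delta_mx i a + delta_mx j b + diag_mx nu <->
  two_kerdim i a j b (fl V) (fl V') /\
  forall k, (\dim (fl V' k))%:Z = pre nu k + (a < k)%N%:R + (b < k)%N%:R.
Proof.
move=> ia jb; rewrite (@relpos_kerdim _ _ _ _
  (fun k l => ((i < k <= a) && (a < l)) + ((j < k <= b) && (b < l)))%N) => [|k l kl|k l kl].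
- by split=> -[h1 h2]; split=> // k; rewrite h2 cumD !cum_delta; lia.
- by rewrite !cumD !cum_delta; lia.
- rewrite !cumD !cum_delta; lia.
Qed.

End Flags.

(** * Counting intermediate flags *)

Section Counting.
Variables (F : finFieldType) (n d : nat).
Implicit Types (V : flag F n d) (C : 'M[int]_n) (nu : 'rV[int]_n).

(** Taking step [j.+1] of the intermediate flag is a bijection, with inverse [mid_chain]. *)
Lemma card_steps (i a j b : 'I_n) V V' : (i < a)%N -> (j < b)%N ->
  (forall k, fl V' k <= fl V k)%VS -> two_dims i a j b (fl V) (fl V') ->
  #|[set V'' : flag F n d | `[< step i a (fl V) (fl V'') /\ step j b (fl V'') (fl V') >]]| =
  #|[set W | mid_pred i a j b (fl V) (fl V') W]|.
Proof.
move=> ia jb VV' dVV'; set A := [set V'' : flag F n d | _].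
have AP V'' : V'' \in A -> step i a (fl V) (fl V'') /\ step j b (fl V'') (fl V').
  by rewrite finset.in_set => /asboolP.
have cfl := @fl_chain F n d.
have fromA V'' : V'' \in A -> (forall k, fl V'' k = mid_chain j (fl V') (fl V'' j.+1) k) /\
    mid_pred i a j b (fl V) (fl V') (fl V'' j.+1).
  by move=> /AP[s1 s2]; apply: steps_mid_pred s1 s2.
rewrite -(@card_in_imset _ _ (fun V'' => fl V'' j.+1)) => [|V1 V2 /fromA[E1 _] /fromA[E2 _] E].
  apply: eq_card => W; rewrite [RHS]finset.in_set; apply/imsetP/idP => [[V'' /fromA[_ ?] ->]//|WP].
  have [cY s1 s2] := mid_pred_steps ia jb (cfl V) (cfl V') VV' dVV' WP.
  have [||V'' V''E] := @flag_of_chain F n d _ cY.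
  - by rewrite /mid_chain fl0.
  - move=> k nk; rewrite /mid_chain leqNgt (leq_trans (ltn_ord j) nk) /=.
    by rewrite fl_ge // (addv_idPl (subvf _)).
  have VE : fl V'' = mid_chain j (fl V') W by apply: funext.
  exists V''; first by rewrite finset.in_set; apply/asboolP; rewrite VE.
  rewrite VE /mid_chain ltnn; apply/esym/addv_idPr.
  by move: WP; rewrite /mid_pred inE => /and4P[/and3P[]].
by apply: fl_inj => k; rewrite E1 E2 E.
Qed.

Lemma relpos_step (i a : 'I_n) V V' nu : (i < a)%N ->
  relpos V V' = delta_mx i a + diag_mx nu <->
  step i a (fl V) (fl V') /\ forall k, (\dim (fl V' k))%:Z = pre nu k + (a < k)%N%:R.
Proof.
move=> ia; rewrite relpos_single 1?ltnW //; split=> -[h1 h2]; split=> //.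
  by apply: (kerdim_step (N := n)) h1 => // [k nk||]; rewrite ?fl_ge //; exact: fl_chain.
by apply: step_kerdim h1; exact: fl_chain.
Qed.

Lemma card_relpos2 (i a j b : 'I_n) V V' nu : (i < a)%N -> (j < b)%N ->
  #|[set V'' : flag F n d |
      (relpos V V'' == delta_mx i a + diag_mx (nu + delta_mx 0 j)) &&
      (relpos V'' V' == delta_mx j b + diag_mx (nu + delta_mx 0 a))]| =
  if relpos V V' == delta_mx i a + delta_mx j b + diag_mx nu
  then hall1 #|F| i a j b
  else if [&& (i < j <= a)%N, (a < b)%N &
    relpos V V' == delta_mx i b + delta_mx j a + diag_mx nu]
  then hall2 #|F| a j else 0%N.
Proof.
move=> ia jb; have cfl := @fl_chain F n d.
set A := [set V'' : flag F n d | _].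
(* The diagonal [nu] fixes only these dimensions, which are symmetric in [a] and [b] and so common
   to both middle terms. *)
pose dims := forall k, (\dim (fl V' k))%:Z = pre nu k + (a < k)%N%:R + (b < k)%N%:R.
have AE V'' : V'' \in A <->
    (step i a (fl V) (fl V'') /\ step j b (fl V'') (fl V')) /\ dims.
  rewrite finset.in_set; split.
    case/andP => /eqP/(relpos_step _ _ _ ia)[s1 d1] /eqP/(relpos_step _ _ _ jb)[s2 d2].
    by split=> // k; rewrite d2 preD pre_delta.
  case=> -[s1 s2] dV'; apply/andP; split; apply/eqP.
    apply/(relpos_step _ _ _ ia); split=> // k; have [_ dY _] := s2.
    rewrite dY PoszD dV' preD pre_delta; lia.
  by apply/(relpos_step _ _ _ jb); split=> // k; rewrite dV' preD pre_delta.
have cardA : dims -> (forall k, fl V' k <= fl V k)%VS -> two_dims i a j b (fl V) (fl V') ->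
    #|A| = #|[set W | mid_pred i a j b (fl V) (fl V') W]|.
  move=> dV' VV' dVV'; rewrite -card_steps //; apply: eq_card => V''.
  rewrite [RHS]finset.in_set; apply/idP/asboolP => [/AE[]//|s]; exact/AE.
have tdims (i0 a0 j0 b0 : 'I_n) : two_kerdim i0 a0 j0 b0 (fl V) (fl V') ->
    two_dims i0 a0 j0 b0 (fl V) (fl V').
  by apply: (two_kerdim_dims (N := n)) => // k nk; rewrite !fl_ge.
case: eqP => [/(relpos_double _ _ _ (ltnW ia) (ltnW jb))[k1 d1]|n1].
  have [VV' _] := k1; rewrite cardA ?card_mid1 //; exact: tdims.
case: (boolP [&& _, _ & _]) => [/and3P[ija ab /eqP C2]|n2].
  have ib : (i <= b)%N by lia.
  have ja : (j <= a)%N by lia.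
  move/(relpos_double _ _ _ ib ja): C2 => [k2 d2].
  have td : two_dims i a j b (fl V) (fl V').
    by move=> k; rewrite (tdims _ _ _ _ k2 k); lia.
  have [VV' _] := k2; rewrite cardA ?card_mid2 // => k.
  by rewrite d2 addrAC.
(* By [step_comp], an intermediate flag would force one of the two excluded matrices. *)
apply: eq_card0 => V''; apply/negP => /AE[[s1 s2] dV'].
have := step_comp ia jb (cfl V) (cfl V'') (cfl V') s1 s2.
case: ifP => [/and4P[ij ja ab _] k2|_ k1].
  have ib : (i <= b)%N by lia.
  case/negP: n2; rewrite ij ja ab /=; apply/eqP/(relpos_double _ _ _ ib ja).
  by split=> // k; rewrite dV' addrAC.
by apply: n1; apply/(relpos_double _ _ _ (ltnW ia) (ltnW jb)).
Qed.

Lemma relpos_diag (i : 'I_n) V V' nu :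
  relpos V V' = diag_mx nu <-> V = V' /\ forall k, (\dim (fl V' k))%:Z = pre nu k.
Proof.
(* Splitting off a diagonal unit allows [relpos_single] with the empty interval [(i, i]]. *)
have -> : diag_mx nu = delta_mx i i + diag_mx (nu - delta_mx 0 i).
  apply/matrixP => x y; rewrite !mxE eqxx /=.
  case: (eqVneq x y) => [<-|xy].
    by rewrite !mulr1n; case: (x == i); rewrite /= ?addr0 ?add0r ?subr0 // addrC subrK.
  rewrite !mulr0n addr0; case: eqP => //= xi; case: eqP => //= yi.
  by rewrite xi yi eqxx in xy.
have dimE k : pre (nu - delta_mx 0 i) k + (i < k)%N%:R = pre nu k.
  by rewrite -(pre_delta i) -preD subrK.
rewrite relpos_single //; split=> [[[VV' h1] h2]|[-> h2]].
  split=> [|k]; last by rewrite h2 dimE.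
  apply: fl_inj => k; apply: eq_subv_dim (VV' k) _.
  have := h1 k (maxn k n) (leq_maxl _ _); rewrite (fl_ge _ (leq_maxr _ _)) capvf => ->; lia.
split=> [|k]; last by rewrite h2 dimE.
split=> // k l kl; rewrite (capv_idPl (fl_chain V' kl)); lia.
Qed.

End Counting.

Lemma diag_mx_delta (n : nat) (i : 'I_n) : diag_mx (delta_mx 0 i) = delta_mx i i :> 'M[int]_n.
Proof.
apply/matrixP => x y; rewrite !mxE eqxx /=.
case: (eqVneq x y) => [<-|xy]; first by rewrite mulr1n andbb.
by rewrite mulr0n; case: eqP => //= xi; case: eqP => //= yi; rewrite xi yi eqxx in xy.
Qed.

Lemma hall1_diag q i a j b : (a <= i)%N || (b <= j)%N -> hall1 q i a j b = 1%N.
Proof. by move=> h; rewrite /hall1 !ifF //; lia. Qed.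

(** If [i = a] or [j = b], that factor is diagonal and forces [V'' = V] or [V'' = V'], so the count
    is at most one. *)
Lemma card_relpos (F : finFieldType) (n d : nat) (i a j b : 'I_n) (V V' : flag F n d)
    (nu : 'rV[int]_n) : (i <= a)%N -> (j <= b)%N ->
  #|[set V'' : flag F n d |
      (relpos V V'' == delta_mx i a + diag_mx (nu + delta_mx 0 j)) &&
      (relpos V'' V' == delta_mx j b + diag_mx (nu + delta_mx 0 a))]| =
  if relpos V V' == delta_mx i a + delta_mx j b + diag_mx nu
  then hall1 #|F| i a j b
  else if [&& (i < j <= a)%N, (a < b)%N &
    relpos V V' == delta_mx i b + delta_mx j a + diag_mx nu]
  then hall2 #|F| a j else 0%N.
Proof.
rewrite leq_eqVlt => /predU1P[/val_inj <-{a} jb|ia].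
  have -> : delta_mx i i + diag_mx (nu + delta_mx 0 j) =
      diag_mx (nu + delta_mx 0 j + delta_mx 0 i) :> 'M[int]_n.
    by rewrite !linearD /= -diag_mx_delta addrC.
  have -> : delta_mx i i + delta_mx j b + diag_mx nu =
      delta_mx j b + diag_mx (nu + delta_mx 0 i) :> 'M[int]_n.
    by rewrite !linearD /= -diag_mx_delta -addrA addrC addrA.
  rewrite [[&& _, _ & _]](_ : _ = false); last by lia.
  rewrite hall1_diag ?leqnn ?orbT //.
  case: eqP => [C1|nC1].
    apply: etrans (cards1 V); apply: eq_card => V''; rewrite finset.in_set finset.in_set1.
    apply/andP/eqP => [[/eqP/(relpos_diag i)[-> _]]//|->].
    split; last by apply/eqP.
    apply/eqP/(relpos_diag i); split=> // k.
    have [h1 h2] := (relpos_single _ _ _ jb).1 C1.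
    have [_ h] := h1; have := h k (maxn k n) (leq_maxl _ _).
    rewrite (fl_ge _ (leq_maxr _ _)) capvf => ->; rewrite PoszD h2 !preD !pre_delta.
    have := ltn_ord b; lia.
  apply: eq_card0 => V''; rewrite finset.in_set; apply/negP.
  by case/andP => /eqP/(relpos_diag i)[<- _] /eqP.
rewrite leq_eqVlt => /predU1P[/val_inj <-{b}|jb]; last exact: card_relpos2.
have -> : delta_mx j j + diag_mx (nu + delta_mx 0 a) =
    diag_mx (nu + delta_mx 0 a + delta_mx 0 j) :> 'M[int]_n.
  by rewrite !linearD /= -diag_mx_delta addrC.
have -> : delta_mx i a + delta_mx j j + diag_mx nu =
    delta_mx i a + diag_mx (nu + delta_mx 0 j) :> 'M[int]_n.
  by rewrite !linearD /= -diag_mx_delta -!addrA [_ + diag_mx nu]addrC.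
rewrite [[&& (i < j <= a)%N, _ & _]](_ : _ = false); last by lia.
rewrite hall1_diag ?leqnn ?orbT //.
case: eqP => [C1|nC1].
  apply: etrans (cards1 V'); apply: eq_card => V''; rewrite finset.in_set finset.in_set1.
  apply/andP/eqP => [[_ /eqP/(relpos_diag i)[-> _]]//|->].
  split; first by apply/eqP.
  apply/eqP/(relpos_diag i); split=> // k.
  have [h1 h2] := (relpos_single _ _ _ (ltnW ia)).1 C1.
  by rewrite h2 !preD !pre_delta; lia.
apply: eq_card0 => V''; rewrite finset.in_set; apply/negP.
by case/andP => /eqP A /eqP/(relpos_diag i)[E _]; rewrite E in A.
Qed.

(** * Structure constants of the Schur algebra *)

Section FlagPairs.
Variables (F : finFieldType) (n d : nat).

(** The vectors supported on [P], as the kernel of the projection erasing the coordinates in [P]. *)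
Definition coordv (P : pred 'I_d) : {vspace 'rV[F]_d} :=
  lker (linfun (mulmxr (diag_mx (\row_x (~~ P x)%:R) : 'M[F]_d))).

Lemma mem_coordv P v : (v \in coordv P) = [forall x, P x || (v 0 x == 0)].
Proof.
rewrite memv_ker lfunE /= mul_mx_diag; apply/eqP/forallP => [/rowP h x|h].
  by have := h x; rewrite !mxE; case: (P x); rewrite //= mulr1 => ->.
by apply/rowP => x; rewrite !mxE; have := h x; case: (P x) => /= [_|/eqP->]; rewrite ?mulr0 ?mul0r.
Qed.

Lemma coordv_sub (P Q : pred 'I_d) : {subset P <= Q} -> (coordv P <= coordv Q)%VS.
Proof.
move=> PQ; apply/subvP => v; rewrite !mem_coordv => /forallP h; apply/forallP => x.
by have := h x; case/orP => [/PQ|->]; rewrite ?orbT // -topredE /= => ->.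
Qed.

Lemma coordv_cap (P Q : pred 'I_d) : (coordv P :&: coordv Q)%VS = coordv (predI P Q).
Proof.
apply/vspaceP => v; rewrite memv_cap !mem_coordv.
apply/andP/forallP => [[/forallP hP /forallP hQ] x|h].
  by rewrite /= orb_andl hP hQ.
by split; apply/forallP => x; have := h x; rewrite /= orb_andl => /andP[].
Qed.

Lemma dim_coordv_le P : (\dim (coordv P) <= #|P|)%N.
Proof.
pose X := [seq delta_mx 0 x | x <- enum P] : seq 'rV[F]_d.
have -> : #|P| = size X by rewrite size_map -cardE.
apply: leq_trans (dim_span X); apply: dimvS; apply/subvP => v.
rewrite mem_coordv => /forallP h; rewrite (row_sum_delta v) rpred_sum // => x _.
have := h x; case/orP => [Px|/eqP ->]; last by rewrite scale0r rpred0.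
by rewrite rpredZ // memv_span // map_f // mem_enum.
Qed.

(** Rank-nullity for that projection: the upper bounds for [P] and its complement add up to [d], so
    both are attained. *)
Lemma dim_coordv P : \dim (coordv P) = #|P|.
Proof.
apply/eqP; rewrite eqn_leq dim_coordv_le /=.
pose f : 'End('rV[F]_d) := linfun (mulmxr (diag_mx (\row_x (~~ P x)%:R))).
have := limg_ker_dim f fullv; rewrite capfv dimvf /dim /= mul1n.
have : (limg f <= coordv (predC P))%VS.
  apply/subvP => w /memv_imgP[v _ ->]; rewrite mem_coordv; apply/forallP => x.
  by rewrite lfunE /= mul_mx_diag !mxE /=; case: (P x); rewrite //= mulr0.
move/dimvS => h1 h2; change (lker f) with (coordv P) in h2.
rewrite -(leq_add2r (\dim (limg f))) h2 -[leqRHS]card_ord -(cardC P) leq_add2l.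
apply: leq_trans h1 (leq_trans (dim_coordv_le _) _).
by rewrite leq_eqVlt; apply/orP; left; apply/eqP/eq_card.
Qed.

(** Each basis vector is assigned a cell, cell [(i, j)] being used [C i j] times; the first [k] rows
    span step [k] of [V], the first [k] columns that of [V']. *)
Lemma exists_relpos (C : 'M[int]_n) : inTheta d C ->
  exists V V' : flag F n d, relpos V V' = C.
Proof.
move=> /andP[/forallP C0 /eqP Cd].
have {}C0 i j : C i j = `|C i j|%N by have /forallP/(_ j) := C0 i; lia.
pose s := flatten [seq nseq `|C p.1 p.2| p | p <- enum [set: 'I_n * 'I_n]].
have countE (P : pred ('I_n * 'I_n)) :
    (count P s)%:Z = \sum_i \sum_j (if P (i, j) then C i j else 0).
  rewrite pair_big /= /s count_flatten -map_comp sumnE big_map big_enum /=.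
  rewrite (raddf_sum Posz); apply: eq_big => [p|[i j] _]; first by rewrite inE.
  by rewrite /= count_nseq [in RHS]C0; case: (P _); rewrite ?mul1n.
have sd : size s == d.
  by rewrite -eqz_nat -count_predT countE -Cd.
pose t := Tuple sd.
have cardP (P : pred ('I_n * 'I_n)) : #|[pred x | P (tnth t x)]| = count P s.
  transitivity (count P [seq tnth t x | x <- enum 'I_d]); last by rewrite map_tnth_enum.
  by rewrite cardE {1}/enum_mem size_filter -enumT count_map; apply: eq_count.
pose X k := coordv [pred x | ((tnth t x).1 < k)%N].
pose Y k := coordv [pred x | ((tnth t x).2 < k)%N].
have coordv0 (P : pred 'I_d) : P =1 pred0 -> coordv P = 0%VS.
  by move=> P0; apply/eqP; rewrite -dimv_eq0 dim_coordv (eq_card0 P0).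
have coordvT (P : pred 'I_d) : P =1 predT -> coordv P = fullv.
  move=> PT; apply/vspaceP => v; rewrite memvf mem_coordv; apply/forallP => x.
  by rewrite PT.
have [|||V VE] := @flag_of_chain F n d X.
- by move=> k l kl; apply: coordv_sub => x /=; rewrite !inE => /leq_trans; apply.
- exact: coordv0.
- by move=> k nk; apply: coordvT => x /=; rewrite (leq_trans _ nk).
have [|||V' VE'] := @flag_of_chain F n d Y.
- by move=> k l kl; apply: coordv_sub => x /=; rewrite !inE => /leq_trans; apply.
- exact: coordv0.
- by move=> k nk; apply: coordvT => x /=; rewrite (leq_trans _ nk).
exists V, V'; apply/relpos_cum => k l; rewrite VE VE' coordv_cap dim_coordv.
rewrite (cardP [pred p : 'I_n * 'I_n | (p.1 < k)%N && (p.2 < l)%N]) countE /cum.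
rewrite [RHS]big_mkcond; apply: eq_bigr => i _; rewrite /=.
case: ltnP => ik /=; last by rewrite big1.
by rewrite -big_mkcond.
Qed.

End FlagPairs.

(** * Uniqueness of the structure constants *)

Lemma poly_eq0_unbounded (K : idomainType) (p : {poly K}) (f : nat -> K) (S : pred nat) :
  injective f -> (forall m, exists2 k, (m < k)%N & S k) ->
  (forall k, S k -> root p (f k)) -> p = 0.
Proof.
move=> f_inj Sunb Sroot; apply: contrapT => /eqP p0.
(* As [S] is unbounded, [size p] distinct elements can be collected in it, which is one root too
   many. *)
have [s [M [us ss Ss]]] : exists s, exists M, [/\ uniq s, size s = size p
    & all (fun k => S k && (k <= M)%N) s].
  elim: (size p) => [|m [s [M [us ss Ss]]]]; first by exists [::], 0%N.
  have [k Mk Sk] := Sunb M; exists (k :: s), k; split; rewrite /= ?ss ?us ?Sk ?leqnn //.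
    by rewrite andbT; apply/negP => /(allP Ss)/andP[_]; rewrite leqNgt Mk.
  by apply: sub_all Ss => x /andP[-> /leq_trans]; apply; exact: ltnW.
have := max_poly_roots p0 (rs := [seq f k | k <- s]).
rewrite map_inj_uniq // us size_map ss ltnn => H.
suff : false by []; apply: H => //; rewrite all_map.
by apply: sub_all Ss => k /andP[/Sroot].
Qed.

Lemma prime_odd_unbounded m : exists2 p, (m < p)%N & prime p && (2 < p)%N.
Proof.
by case: (prime_above (maxn m 2)) => p; rewrite gtn_max => /andP[mp p2] pp; exists p; rewrite ?pp.
Qed.

Lemma qv_neq0 : qv != 0 :> Qv.
Proof. by rewrite tofrac_eq0 polyX_eq0. Qed.

(** With denominators cleared, two integer polynomials agree at the square root of every odd prime;
    [exists_relpos] provides the flags over ['F_p] at which to compare. *)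
Lemma is_schur_const_inj (n d : nat) (A B C : 'M[int]_n) (g h : Qv) : inTheta d C ->
  is_schur_const d A B C g -> is_schur_const d A B C h -> g = h.
Proof.
move=> Cd [P [m [-> Pval]]] [Q [k [-> Qval]]].
suff PQ : P * 'X^k = Q * 'X^m.
  have /(congr1 (fun p => tofrac (map_poly intr p : {poly rat}))) := PQ.
  rewrite /= !rmorphM /= !map_polyXn !tofracXn => PQ'.
  by apply/eqP; rewrite eqr_div ?expf_neq0 ?qv_neq0 //; apply/eqP.
have int_inj : injective (intr : int -> algC) by exact: intr_inj.
have mapE (p : {poly int}) r :
    map_poly intr (p * 'X^r) = map_poly intr p * 'X^r :> {poly algC}.
  by rewrite rmorphM /= map_polyXn.
apply: (map_inj_poly int_inj) => //; apply/eqP; rewrite -subr_eq0; apply/eqP.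
apply: (poly_eq0_unbounded (f := fun p => sqrtC p%:R)) prime_odd_unbounded _.
  by move=> p q /sqrtC_inj/eqP; rewrite eqr_nat => /eqP.
move=> p /andP[p_pr p2]; have nchar : 2%N \notin [pchar 'F_p].
  rewrite (pcharf_eq (pchar_Fp p_pr)) inE; apply/eqP; lia.
have [V [V' VC]] := exists_relpos 'F_p Cd.
have := Pval _ nchar V V' VC; rewrite -(Qval _ nchar V V' VC) card_Fp // => /eqP.
have s0 : sqrtC p%:R != 0 :> algC by rewrite sqrtC_eq0 pnatr_eq0; lia.
rewrite eqr_div ?expf_neq0 // => /eqP PQ.
by rewrite /root hornerD hornerN !mapE !hornerM !hornerXn PQ subrr.
Qed.

Lemma schur_const_eq (n d : nat) (A B C : 'M[int]_n) (g : Qv) : inTheta d C ->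
  is_schur_const d A B C g -> schur_const d A B C = g.
Proof.
by move=> Cd gP; apply: xget_unique => // h hP; apply: is_schur_const_inj hP gP.
Qed.

(** * Hall polynomials *)

Definition hall1_poly {R : nzRingType} (q : R) (i a j b : nat) : R :=
  if [&& i == j, a == b & (i < a)%N] then q + 1
  else if (i <= j < a)%N && (a <= b)%N then q else 1.

Definition hall2_poly {R : nzRingType} (q : R) (a j : nat) : R :=
  if j == a then 1 else q - 1.

Lemma schur_const_upper (n d : nat) (i a j b : 'I_n) (nu : 'rV[int]_n) C :
  (i <= a)%N -> (j <= b)%N -> inTheta d C ->
  schur_const d (delta_mx i a + diag_mx (nu + delta_mx 0 j))
                (delta_mx j b + diag_mx (nu + delta_mx 0 a)) C =
  if C == delta_mx i a + delta_mx j b + diag_mx nu then hall1_poly (qv ^+ 2) i a j b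
  else if [&& (i < j <= a)%N, (a < b)%N & C == delta_mx i b + delta_mx j a + diag_mx nu]
  then hall2_poly (qv ^+ 2) a j else 0.
Proof.
move=> ia jb Cd; apply: schur_const_eq => //.
(* The counts are polynomials in [q], so at the square root of [q] they become polynomials in
   ['X^2], without denominator. *)
exists (if C == delta_mx i a + delta_mx j b + diag_mx nu then hall1_poly ('X^2) i a j b
  else if [&& (i < j <= a)%N, (a < b)%N & C == delta_mx i b + delta_mx j a + diag_mx nu]
  then hall2_poly ('X^2) a j else 0), 0%N; split.
  rewrite expr0 divr1 /hall1_poly /hall2_poly.
  repeat case: ifP => _; rewrite ?rmorphD ?rmorphN /= ?rmorph1 ?rmorph0
    ?map_polyXn ?tofracXn //.
move=> F _ V V' VC; rewrite expr0 divr1.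
have F0 : (0 < #|F|)%N by apply/card_gt0P; exists 0.
rewrite (card_relpos _ _ _ ia jb) VC /hall1_poly /hall2_poly /hall1 /hall2.
repeat case: ifP => _; rewrite ?rmorphD ?rmorphN /= ?rmorph1 ?rmorph0
   ?map_polyXn ?hornerD ?hornerN ?hornerXn ?hornerC ?sqrtCK ?natr1 //.
by rewrite -subn1 natrB.
Qed.

(** * Structure constants of K *)

Lemma qvX_inj : injective (fun p : nat => qv ^- p : Qv).
Proof.
move=> p k /invr_inj; rewrite -!tofracXn => /eqP; rewrite tofrac_eq => /eqP.
by move/(congr1 (size \o polyseq)); rewrite /= !size_polyXn => -[].
Qed.

Lemma shift_inj (n p : nat) : injective (@shift n p).
Proof. by move=> A B /addIr. Qed.

Lemma inTheta_inj (n d d' : nat) (A : 'M[int]_n) : inTheta d A -> inTheta d' A -> d = d'.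
Proof. by case/andP=> _ /eqP dE /andP[_]; rewrite dE eqz_nat => /eqP. Qed.

(** For all large [p] both lists give the coefficient of the same basis element, so the total
    polynomials attached to [C] agree at the infinitely many points [qv ^- p]. *)
Lemma stabilizes_coef (n : nat) (A B C : 'M[int]_n) s s' :
  stabilizes A B s -> stabilizes A B s' ->
  \sum_(ZG <- s | ZG.1 == C) ZG.2 = \sum_(ZG <- s' | ZG.1 == C) ZG.2.
Proof.
move=> [_ [p0 sP]] [_ [p0' sP']]; apply/eqP; rewrite -subr_eq0; apply/eqP.
apply: (poly_eq0_unbounded (S := fun p => (maxn p0 p0' <= p)%N) qvX_inj) => [m|p].
  by exists (maxn m.+1 (maxn p0 p0')); rewrite ?leq_maxl ?leq_maxr.
rewrite geq_max => /andP[/sP[d [Ad _ _ sE]] /sP'[d' [Ad' _ _ sE']]].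
have dd' := inTheta_inj Ad Ad'; rewrite -dd' in sE'.
pose w : Qv := qv ^ (- br_exponent (shift p C)).
have sumE (r : seq ('M[int]_n * {poly Qv})) :
    \sum_(ZG <- r) ZG.2.[qv ^- p] * schur_br (shift p ZG.1) (shift p C) =
    (\sum_(ZG <- r | ZG.1 == C) ZG.2).[qv ^- p] * w.
  rewrite horner_sum big_distrl /= [RHS]big_mkcond; apply: eq_bigr => -[Z G] _ /=.
  rewrite /schur_br (inj_eq (@shift_inj n p)) eq_sym.
  by case: eqP => [->|_]; rewrite ?mulr0.
have /eqP := sE (shift p C); rewrite sE' !sumE.
have w0 : w != 0 by rewrite expfz_neq0 // qv_neq0.
by rewrite (inj_eq (mulIf w0)) /root hornerD hornerN => /eqP->; rewrite subrr.
Qed.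

Lemma K_const_eq (n : nat) (A B C : 'M[int]_n) s : co A = ro B -> stabilizes A B s ->
  K_const A B C = \sum_(ZG <- s | ZG.1 == C) ZG.2.[1].
Proof.
move=> AB sP; rewrite /K_const AB eqxx -!horner_sum; congr (_.[1]).
exact: stabilizes_coef (xgetPex [::] (ex_intro _ s sP)) sP.
Qed.

(** * Normalization exponents *)

Section Exponents.
Variable n : nat.
Implicit Types (A B : 'M[int]_n) (nu : 'rV[int]_n) (i j a b : 'I_n).

(** The bilinear form behind the quadratic form [br_exponent]. *)
Definition bilin A B : int :=
  \sum_(i < n) \sum_(k < n | (k <= i)%N)
    \sum_(j < n) \sum_(l < n | (j < l)%N) A i j * B k l.

Lemma bilinDl A A' B : bilin (A + A') B = bilin A B + bilin A' B.
Proof.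
rewrite /bilin; do 4![rewrite -big_split; apply: eq_bigr => ? _ /=].
by rewrite mxE mulrDl.
Qed.

Lemma bilinDr A B B' : bilin A (B + B') = bilin A B + bilin A B'.
Proof.
rewrite /bilin; do 4![rewrite -big_split; apply: eq_bigr => ? _ /=].
by rewrite mxE mulrDr.
Qed.

Definition seg nu (x y : nat) : int := \sum_(m < n | (x <= m < y)%N) nu 0 m.

Lemma bilin_deltal i a B :
  bilin (delta_mx i a) B = \sum_(k < n | (k <= i)%N) \sum_(l < n | (a < l)%N) B k l.
Proof.
rewrite /bilin (bigD1 i) //= [X in _ + X]big1 ?addr0 => [|x xi]; last first.
  do 3![rewrite big1 // => ? _]; rewrite mxE (negPf xi) mul0r //.
apply: eq_bigr => k _; rewrite (bigD1 a) //= [X in _ + X]big1 ?addr0 => [|x xa].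
  by apply: eq_bigr => l _; rewrite mxE !eqxx mul1r.
by rewrite big1 // => l _; rewrite mxE (negPf xa) andbF mul0r.
Qed.

Lemma bilin_delta_delta i a j b :
  bilin (delta_mx i a) (delta_mx j b) = ((j <= i) && (a < b))%N%:R.
Proof.
rewrite bilin_deltal; case: (leqP j i) => ji; last first.
  rewrite big1 // => k ki; rewrite big1 // => l _; rewrite mxE.
  by case: eqP => // kj; move: ki; rewrite kj leqNgt ji.
rewrite (bigD1 j) //= [X in _ + X]big1 ?addr0 => [|k /andP[_ kj]]; last first.
  by rewrite big1 // => l _; rewrite mxE (negPf kj).
case: (ltnP a b) => ab; last first.
  rewrite big1 // => l al; rewrite mxE eqxx /=.
  by case: eqP => // lb; move: al; rewrite lb ltnNge ab.
rewrite (bigD1 b) //= [X in _ + X]big1 ?addr0 => [|l /andP[_ lb]]; last first.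
  by rewrite mxE (negPf lb) andbF.
by rewrite mxE !eqxx.
Qed.

Lemma bilin_delta_diag i a nu : (i <= a)%N -> bilin (delta_mx i a) (diag_mx nu) = 0.
Proof.
move=> ia; rewrite bilin_deltal big1 // => k ki; rewrite big1 // => l al.
rewrite mxE; case: eqP => // kl; move: al; rewrite -kl ltnNge.
by rewrite (leq_trans ki ia).
Qed.

Lemma bilin_diag_delta i a nu : bilin (diag_mx nu) (delta_mx i a) = seg nu i a.
Proof.
rewrite /bilin /seg [RHS]big_mkcond; apply: eq_bigr => x _.
case: (leqP i x) => ix /=; last first.
  rewrite big1 // => k kx; rewrite big1 // => j _; rewrite big1 // => l _.
  rewrite [delta_mx i a k l]mxE; case: eqP => [ki|]; last by rewrite mulr0.
  by move: kx; rewrite ki leqNgt ix.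
rewrite (bigD1 i) //= [X in _ + X]big1 ?addr0 => [|k /andP[_ ki]]; last first.
  rewrite big1 // => j _; rewrite big1 // => l _.
  by rewrite [delta_mx i a k l]mxE (negPf ki) mulr0.
rewrite (bigD1 x) //= [X in _ + X]big1 ?addr0 => [|y yx]; last first.
  by rewrite big1 // => l _; rewrite mxE eq_sym (negPf yx) mulr0n mul0r.
case: (ltnP x a) => xa; last first.
  rewrite big1 // => l xl; rewrite [delta_mx i a i l]mxE eqxx /=.
  by case: eqP => [la|]; [move: xl; rewrite la ltnNge xa | rewrite mulr0].
rewrite (bigD1 a) //= [X in _ + X]big1 ?addr0 => [|l /andP[_ la]]; last first.
  by rewrite [delta_mx i a i l]mxE (negPf la) andbF mulr0.
by rewrite !mxE !eqxx mulr1n mulr1.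
Qed.

Lemma bilin_diag_diag nu nu' : bilin (diag_mx nu) (diag_mx nu') = 0.
Proof.
rewrite /bilin big1 // => x _; rewrite big1 // => k kx; rewrite big1 // => y _.
rewrite big1 // => l yl; rewrite !mxE; case: eqP => [xy|]; last by rewrite mulr0n mul0r.
case: eqP => [kl|]; last by rewrite mulr0n mulr0.
by move: yl; rewrite -kl -xy ltnNge kx.
Qed.

(** Only the pairing of the diagonal part with the matrix unit survives. *)
Lemma br_exponent_single i a nu : (i <= a)%N ->
  br_exponent (delta_mx i a + diag_mx nu) = seg nu i a.
Proof.
move=> ia; rewrite -[LHS]/(bilin _ _) !(bilinDl, bilinDr) bilin_diag_diag.
rewrite bilin_delta_diag // bilin_diag_delta bilin_delta_delta; lia.
Qed.

Lemma br_exponent_double i a j b nu : (i <= a)%N -> (j <= b)%N ->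
  br_exponent (delta_mx i a + delta_mx j b + diag_mx nu) = seg nu i a + seg nu j b +
    ((j <= i) && (a < b))%N%:R + ((i <= j) && (b < a))%N%:R.
Proof.
move=> ia jb; rewrite -[LHS]/(bilin _ _) !(bilinDl, bilinDr) bilin_diag_diag.
rewrite !bilin_delta_diag // !bilin_diag_delta !bilin_delta_delta; lia.
Qed.

Lemma segD nu nu' x y : seg (nu + nu') x y = seg nu x y + seg nu' x y.
Proof. by rewrite /seg -big_split; apply: eq_bigr => m _; rewrite mxE. Qed.

Lemma seg_delta i x y : seg (delta_mx 0 i) x y = (x <= i < y)%N%:R.
Proof.
rewrite /seg; case: (boolP (x <= i < y)%N) => xiy.
  rewrite (bigD1 i) //= [X in _ + X]big1 ?addr0 ?mxE ?eqxx // => m /andP[_ mi].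
  by rewrite mxE (negPf mi) andbF.
rewrite big1 // => m xmy; rewrite mxE eqxx; case: eqP => //= mi.
by rewrite -mi xmy in xiy.
Qed.

Lemma seg_cat nu x y z : (x <= y <= z)%N -> seg nu x z = seg nu x y + seg nu y z.
Proof.
move=> xyz; rewrite /seg (bigID (fun m : 'I_n => (m < y)%N)) /=.
by congr (_ + _); apply: eq_bigl => m; lia.
Qed.

End Exponents.

(* The exponents of v are br_exponent C - br_exponent A - br_exponent B for the
   two matrices C occurring in the product [A] * [B]; see stabilizes_upper. *)
Definition prod_coef1 {R : fieldType} (v : R) (i a j b : nat) : R :=
  v ^ (((j <= i) && (a < b))%N%:R + ((i <= j) && (b < a))%N%:R
       - (i <= j < a)%N%:R - (j <= a < b)%N%:R) * hall1_poly (v ^+ 2) i a j b.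

Definition prod_coef2 {R : fieldType} (v : R) (i a j b : nat) : R :=
  if (i < j <= a)%N && (a < b)%N
  then v ^ (- (j < a)%N%:R) * hall2_poly (v ^+ 2) a j else 0.

Lemma sum_const_pair (K : comNzRingType) (T : Type) (x y : T) (c e z : K) (f : T -> K) :
  \sum_(t <- [:: (x, c%:P); (y, e%:P)]) t.2.[z] * f t.1 = c * f x + e * f y.
Proof. by rewrite big_cons big_seq1 !hornerC. Qed.

Lemma regroup_exp (R : fieldType) (v h : R) (x y z e : int) : v != 0 -> e = z - x - y ->
  v ^ (- x) * v ^ (- y) * h = v ^ e * h * v ^ (- z).
Proof.
move=> v0 ->; rewrite [RHS]mulrAC -!expfzDr //; congr (v ^ _ * h); ring.
Qed.

(** * Products of two matrix units plus diagonals *)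

Section UpperProduct.
Variable n : nat.
Implicit Types (A B C : 'M[int]_n) (nu : 'rV[int]_n) (i j a b : 'I_n).

Lemma shift_diag p A nu : shift p (A + diag_mx nu) = A + diag_mx (nu + const_mx p%:Z).
Proof. by rewrite /shift linearD /= diag_const_mx addrA. Qed.

Lemma roD A B : ro (A + B) = ro A + ro B.
Proof. by apply/rowP => i; rewrite !mxE -big_split; apply: eq_bigr => j _; rewrite mxE. Qed.

Lemma coD A B : co (A + B) = co A + co B.
Proof. by apply/rowP => i; rewrite !mxE -big_split; apply: eq_bigr => j _; rewrite mxE. Qed.

Lemma ro_delta i a : ro (delta_mx i a) = delta_mx 0 i.
Proof.
apply/rowP => x; rewrite !mxE eqxx /= (bigD1 a) //= mxE eqxx andbT big1 ?addr0 // => y ya.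
by rewrite mxE (negPf ya) andbF.
Qed.

Lemma co_delta i a : co (delta_mx i a) = delta_mx 0 a.
Proof.
apply/rowP => x; rewrite !mxE eqxx /= (bigD1 i) //= mxE eqxx big1 ?addr0 // => y ya.
by rewrite mxE (negPf ya).
Qed.

Lemma ro_diag nu : ro (diag_mx nu) = nu.
Proof.
apply/rowP => x; rewrite !mxE (bigD1 x) //= mxE eqxx mulr1n big1 ?addr0 // => y yx.
by rewrite mxE eq_sym (negPf yx).
Qed.

Lemma co_diag nu : co (diag_mx nu) = nu.
Proof.
apply/rowP => x; rewrite !mxE (bigD1 x) //= mxE eqxx mulr1n big1 ?addr0 // => y yx.
by rewrite mxE (negPf yx).
Qed.

Lemma inThetaE d A : inTheta d A = [forall i, forall j, 0 <= A i j] && (cum A n n == d%:Z).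
Proof.
congr (_ && (_ == _)); apply: eq_big => [i|i _]; first by rewrite ltn_ord.
by apply: eq_bigl => j; rewrite ltn_ord.
Qed.

Lemma nonneg_double i a j b nu : (forall x, 0 <= nu 0 x) ->
  [forall x, forall y, 0 <= (delta_mx i a + delta_mx j b + diag_mx nu) x y].
Proof.
move=> nu0; apply/forallP => x; apply/forallP => y; rewrite !mxE.
by rewrite !addr_ge0 ?ler0n // mulrn_wge0.
Qed.

Lemma nonneg_single i a nu : (forall x, 0 <= nu 0 x) ->
  [forall x, forall y, 0 <= (delta_mx i a + diag_mx nu) x y].
Proof.
move=> nu0; apply/forallP => x; apply/forallP => y; rewrite !mxE.
by rewrite !addr_ge0 ?ler0n // mulrn_wge0.
Qed.

Lemma thetaTilde_double i a j b nu : inThetaTilde (delta_mx i a + delta_mx j b + diag_mx nu).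
Proof.
apply/forallP => x; apply/forallP => y; apply/implyP => xy.
by rewrite !mxE (negPf xy) mulr0n addr0 addr_ge0.
Qed.

Lemma schur_mul_br d A B C : inTheta d A -> inTheta d B ->
  schur_mul d (schur_br A) (schur_br B) C =
  if inTheta d C then qv ^ (- br_exponent A) * qv ^ (- br_exponent B) * schur_const d A B C
  else 0.
Proof.
move=> Ad Bd; rewrite /schur_mul; case: ifP => // _.
rewrite -(@fsbig_widen _ _ _ _ [set A]%classic) => [|x ->|x /= [_ xA]] //; last first.
  by rewrite fsbig1 // => y _; rewrite /schur_br; case: eqP => // _; rewrite !mul0r.
rewrite fsbig_set1 -(@fsbig_widen _ _ _ _ [set B]%classic) => [|x ->|x /= [_ xB]] //; last first.
  by rewrite /schur_br [x == B](introF eqP) // mulr0 mul0r.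
by rewrite fsbig_set1 /schur_br !eqxx.
Qed.

(** The entry at [(i, b)] is 0 on the left and 1 on the right. *)
Lemma swap_neq i a j b nu : (i < j <= a)%N -> (a < b)%N ->
  delta_mx i a + delta_mx j b + diag_mx nu != delta_mx i b + delta_mx j a + diag_mx nu.
Proof.
move=> ija ab; apply/eqP => /matrixP/(_ i b); rewrite !mxE !eqxx /=.
have [nij nba nib] : [/\ i != j, b != a & i != b] by split; apply/eqP => /(congr1 val) /=; lia.
by rewrite (negPf nij) (negPf nba) (negPf nib).
Qed.

(** The parts of the exponents that depend on [nu] cancel, so the coefficients are constant
    polynomials in [qv ^- p]. *)
Lemma stabilizes_upper i a j b nu : (i <= a)%N -> (j <= b)%N ->
  stabilizes (delta_mx i a + diag_mx (nu + delta_mx 0 j))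
             (delta_mx j b + diag_mx (nu + delta_mx 0 a))
    [:: (delta_mx i a + delta_mx j b + diag_mx nu, (prod_coef1 qv i a j b)%:P);
        (delta_mx i b + delta_mx j a + diag_mx nu, (prod_coef2 qv i a j b)%:P)].
Proof.
move=> ia jb; split=> [Z G|].
  rewrite !inE => /orP[] /eqP[-> _]; split; rewrite ?thetaTilde_double //;
    rewrite !(roD, coD, ro_delta, co_delta, ro_diag, co_diag);
    by apply/rowP => x; rewrite !mxE; lia.
(* From this [p] on, all diagonal entries are nonnegative. *)
exists (\sum_x absz (nu 0%R x))%N => p p0.
pose mu := nu + const_mx p%:Z.
have mu0 x : 0 <= mu 0 x.
  have le : `|nu 0 x| <= p%:Z.
    by rewrite -abszE lez_nat; apply: leq_trans p0; rewrite (bigD1 x) //= leq_addr.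
  by move: le; rewrite ler_norml !mxE => /andP[+ _]; rewrite -subr_ge0 opprK.
have muD (k : 'I_n) : nu + delta_mx 0 k + const_mx p%:Z = mu + delta_mx 0 k by rewrite addrAC.
have muD0 k x : 0 <= (mu + delta_mx 0 k) 0 x by rewrite mxE addr_ge0 // mxE ler0n.
have pre0 : 0 <= pre mu n by apply: sumr_ge0.
(* Two matrix units, plus the sum of the diagonal [mu]. *)
exists (2 + `|pre mu n|)%N.
have inA (k l m : 'I_n) : inTheta (2 + `|pre mu n|) (delta_mx k l + diag_mx (mu + delta_mx 0 m)).
  rewrite inThetaE nonneg_single //= cumD cum_delta cum_diag preD pre_delta minnn.
  rewrite !ltn_ord; lia.
have inC (k l m r : 'I_n) : inTheta (2 + `|pre mu n|) (delta_mx k l + delta_mx m r + diag_mx mu).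
  rewrite inThetaE nonneg_double //= !cumD !cum_delta cum_diag minnn.
  rewrite !ltn_ord; lia.
rewrite !shift_diag !muD; split=> // [Z G|C].
  by rewrite !inE => /orP[] /eqP[-> _]; rewrite shift_diag.
rewrite (schur_mul_br _ (inA _ _ _) (inA _ _ _)).
apply: etrans (esym (sum_const_pair _ _ _ _ _ (fun Z => schur_br (shift p Z) C))).
rewrite !shift_diag -/mu /schur_br.
case: ifP => Cd; last first.
  rewrite [C == _](introF eqP) => [|E]; last by rewrite E inC in Cd.
  rewrite [C == _](introF eqP) => [|E]; last by rewrite E inC in Cd.
  by rewrite !mulr0 addr0.
rewrite schur_const_upper //.
rewrite !br_exponent_single //.
case: eqP => [->|_].
  rewrite [X in _ = _ + X](_ : _ = 0); last first.
    rewrite /prod_coef2; case: ifP => [/andP[ija ab]|_]; last by rewrite mul0r.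
    by rewrite (negPf (swap_neq mu ija ab)) mulr0.
  rewrite addr0; apply: (regroup_exp _ qv_neq0).
  rewrite br_exponent_double // !segD !seg_delta; lia.
rewrite mulr0 add0r /prod_coef2.
case: ifP => [/and3P[ija ab /eqP ->]|nC2].
  rewrite ija ab eqxx /=; apply: (regroup_exp _ qv_neq0).
  rewrite br_exponent_double; try lia.
  (* Cutting both segments at [a] shows that exchanging the right ends preserves the sum of the two
     segments. *)
  have := seg_cat mu (x := i) (y := a) (z := b) ltac:(lia).
  have := seg_cat mu (x := j) (y := a) (z := b) ltac:(lia).
  rewrite !segD !seg_delta; lia.
rewrite mulr0; case: eqP => [E|_]; last by rewrite mulr0.
by move: nC2; rewrite E eqxx andbT => ->; rewrite mul0r.
Qed.

Lemma K_const_upper i a j b nu C : (i <= a)%N -> (j <= b)%N ->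
  K_const (delta_mx i a + diag_mx (nu + delta_mx 0 j))
          (delta_mx j b + diag_mx (nu + delta_mx 0 a)) C =
  prod_coef1 qv i a j b * (C == delta_mx i a + delta_mx j b + diag_mx nu)%:R +
  prod_coef2 qv i a j b * (C == delta_mx i b + delta_mx j a + diag_mx nu)%:R.
Proof.
move=> ia jb; rewrite (K_const_eq _ _ (stabilizes_upper nu ia jb)).
  apply: etrans (sum_const_pair _ _ _ _ 1 (fun Z => (C == Z)%:R)).
  rewrite big_mkcond; apply: eq_bigr => -[Z G] _ /=; rewrite eq_sym.
  by case: eqP => _; rewrite ?mulr1 ?mulr0.
by rewrite roD coD ro_delta co_delta ro_diag co_diag addrC -addrA [RHS]addrCA.
Qed.

End UpperProduct.

(** * The relation *)

(** The scalar relating tbar_ia to the sum of [v^lam_i [E_ia + D_lam]]. For [i = a], splitting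
    [E_ii] off the diagonal lowers [lam_i] by one, whence the factor [v]. *)
Definition tbar_scale {R : fieldType} (v : R) (i a : nat) : R :=
  if (i < a)%N then v - v^-1 else if i == a then v else 0.

(** [x] and [y] stand for the weights of the two families. The factors have diagonals [nu + e_j] and
    [nu + e_a]; the extra power of [v] is the excess of their exponents over [nu_i + nu_j]. *)
Definition tbar_prod {R : fieldType} (v : R) (i a j b : nat) (x y : R) : R :=
  tbar_scale v i a * tbar_scale v j b * v ^+ ((i == j) + (a == j))
  * (prod_coef1 v i a j b * x + prod_coef2 v i a j b * y).

Lemma prod_coef1E (R : fieldType) (v : R) (i a j b : nat) : v != 0 ->
  prod_coef1 v i a j b = v ^+ (((j <= i) && (a < b)) + ((i <= j) && (b < a)))%N /
    v ^+ ((i <= j < a) + (j <= a < b))%N * hall1_poly (v ^+ 2) i a j b.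
Proof.
move=> v0; have divE (p m : nat) : v ^+ p / v ^+ m = v ^ (p%:Z - m%:Z).
  by rewrite expfzDr // -exprnN.
rewrite divE; congr (v ^ _ * _); rewrite !PoszD; lia.
Qed.

Lemma prod_coef2E (R : fieldType) (v : R) (i a j b : nat) :
  prod_coef2 v i a j b = if (i < j <= a)%N && (a < b)%N
  then v ^- (j < a)%N * hall2_poly (v ^+ 2) a j else 0.
Proof. by rewrite /prod_coef2 natz -exprnN. Qed.

(** For each relative order of the four indices this is an identity of rational functions in [v]. If
    [i = j] or [a = b] the two families coincide, whence [x = y]. *)
Lemma tbar_prod_relation (R : fieldType) (v : R) (i a j b : nat) (x y : R) : v != 0 ->
  ((i == j) || (a == b) -> x = y) ->
  v ^- (i == j) * tbar_prod v i a j b x y - v ^- (a == b) * tbar_prod v j b i a x y =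
  (v^-1 - v) * ((b < a)%N%:R - (i < j)%N%:R) * tbar_prod v j a i b y x.
Proof.
move=> v0; rewrite /tbar_prod /tbar_scale !prod_coef1E // !prod_coef2E /hall1_poly /hall2_poly.
case: (ssrnat.ltngtP i j) => ij; rewrite ?ij /=;
case: (ssrnat.ltngtP a b) => ab; rewrite ?ab /= => xy; try rewrite (xy isT);
case: (ssrnat.ltngtP i a) => ia; try (exfalso; lia);
case: (ssrnat.ltngtP j b) => jb; try (exfalso; lia);
case: (ssrnat.ltngtP i b) => ib; try (exfalso; lia);
case: (ssrnat.ltngtP j a) => ja; try (exfalso; lia);
rewrite ?eqxx ?ltnn ?leqnn /= ?addn0 ?add0n ?expr0 ?expr1 ?divr1 ?invr1;
by field; rewrite ?v0 ?oner_eq0.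
Qed.

Lemma regroup_weight (R : fieldType) (s t x y z w c e : R) (p q : bool) : x * y = z * w ->
  s * x * (t * y) * (c * p%:R + e * q%:R) =
  s * t * z * (c * (if p then w else 0) + e * (if q then w else 0)).
Proof.
move=> xy; have -> : s * x * (t * y) = s * t * (x * y) by ring.
rewrite xy; case: p; case: q; rewrite /=; ring.
Qed.

(** * Coefficients of products of generators *)

Section Tbar.
Variable n : nat.
Implicit Types (C E : 'M[int]_n) (i j a b : 'I_n).

Lemma hatA_coefE (Ahat : 'M[nat]_n) (nu : 'rV[int]_n) C :
  let lam := ro C - ro (map_mx Posz Ahat) in
  hatA_coef Ahat nu C =
  if C == map_mx Posz Ahat + diag_mx lam then qv ^ (\sum_k lam 0 k * nu 0 k) else 0.
Proof.
move=> lam; rewrite /hatA_coef -(@fsbig_widen _ _ _ _ [set lam]%classic) //; last first.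
  move=> mu /= [_ mulam]; case: eqP => // E; case: mulam.
  by rewrite /lam E roD ro_diag addrC addKr.
by rewrite fsbig_set1.
Qed.

Lemma tbarE i a C : tbar i a C = tbar_scale qv i a *
  (if C == delta_mx i a + diag_mx (ro C - delta_mx 0 i) then qv ^ (ro C 0 i - 1) else 0).
Proof.
have sum_underline (lam : 'rV[int]_n) : \sum_k lam 0 k * underline i 0 k = lam 0 i.
  rewrite (bigD1 i) //= mxE !eqxx mulr1 big1 ?addr0 // => k ki.
  by rewrite mxE (negPf ki) andbF mulr0.
rewrite /tbar /tbar_scale -(inj_eq val_inj) /=.
case: ifP => [ia|_].
  rewrite -[LHS]/(- (qv^-1 - qv) *: hatA_coef _ _ C) hatA_coefE sum_underline.
  have -> : map_mx Posz (delta_mx i a) = delta_mx i a :> 'M[int]_n.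
    by apply/matrixP => x y; rewrite !mxE; case: (_ && _).
  by rewrite ro_delta !mxE !eqxx opprB.
case: eqP => [/val_inj ia|_]; last by rewrite mul0r.
rewrite -[LHS]/(hatA_coef _ _ C) hatA_coefE sum_underline -ia.
have -> : map_mx Posz 0 = 0 :> 'M[int]_n by apply/matrixP => x y; rewrite !mxE.
have -> : ro 0 = 0 :> 'rV[int]_n by apply/rowP => x; rewrite !mxE big1 // => y _; rewrite mxE.
rewrite subr0 add0r -diag_mx_delta -raddfD /= addrC subrK.
case: eqP => _; last by rewrite mulr0.
by rewrite -[in LHS](subrK 1 (ro C 0 i)) addrC expfzDr ?qv_neq0.
Qed.

Lemma tbar_neq0 i a C : tbar i a C != 0 :> Qv ->
  C = delta_mx i a + diag_mx (ro C - delta_mx 0 i).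
Proof.
move=> t0; apply: contrapT => nE; case/negP: t0.
by rewrite tbarE (introF eqP nE) mulr0.
Qed.

(** The coefficient of [[C]] in the sum over [nu] of [v^(nu_i + nu_j) [E + D_nu]]; row sums
    determine [nu]. *)
Definition weight i j E C : Qv :=
  let nu := ro C - ro E in
  if C == E + diag_mx nu then qv ^ (nu 0 i + nu 0 j) else 0.

(** The row sums of [C] determine the left factor and its column sums the right one, so a single
    pair contributes. *)
Lemma hatK_mul_tbarE i a j b C : hatK_mul (tbar i a) (tbar j b) C =
  tbar_prod qv i a j b (weight i j (delta_mx i a + delta_mx j b) C)
                       (weight i j (delta_mx i b + delta_mx j a) C).
Proof.
have [ia|ai] := leqP i a; last first.
  have s0 : tbar_scale qv i a = 0 by rewrite /tbar_scale ltnNge ltnW // gtn_eqF.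
  rewrite /tbar_prod s0 !mul0r; apply: fsbig1 => -[A B] _ /=.
  by rewrite tbarE s0 !mul0r.
have [jb|bj] := leqP j b; last first.
  have s0 : tbar_scale qv j b = 0 by rewrite /tbar_scale ltnNge ltnW // gtn_eqF.
  rewrite /tbar_prod s0 mulr0 !mul0r; apply: fsbig1 => -[A B] _ /=.
  by rewrite [tbar j b B]tbarE s0 !mul0r mulr0 mul0r.
pose A := delta_mx i a + diag_mx (ro C - delta_mx 0 i).
pose B := delta_mx j b + diag_mx (co C - delta_mx 0 b).
have roA : ro A = ro C by rewrite roD ro_delta ro_diag addrC subrK.
have coB : co B = co C by rewrite coD co_delta co_diag addrC subrK.
have -> : hatK_mul (tbar i a) (tbar j b) C = tbar i a A * tbar j b B * K_const A B C.
  rewrite /= /hatK_mul_coef -(@fsbig_widen _ _ _ _ [set (A, B)]%classic) ?fsbig_set1 //.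
  move=> -[A' B'] /= [_ nAB]; apply: contrapT => /eqP.
  rewrite !mulf_eq0 !negb_or => /andP[/andP[/tbar_neq0 A'E /tbar_neq0 B'E]].
  move=> /K_const_neq0[_ _ roCA coCB]; apply: nAB; congr (_, _).
    by rewrite /A roCA.
  have coB' : co B' = delta_mx 0 b + (ro B' - delta_mx 0 j).
    by rewrite {1}B'E coD co_delta co_diag.
  by rewrite /B coCB coB' [_ + _ - delta_mx 0 b]addrAC subrr add0r.
rewrite !tbarE roA -/A eqxx.
have roB : ro B = delta_mx 0 j + (co C - delta_mx 0 b) by rewrite roD ro_delta ro_diag.
have -> : (B == delta_mx j b + diag_mx (ro B - delta_mx 0 j)) = true.
  by rewrite roB [_ + _ - delta_mx 0 j]addrAC subrr add0r eqxx.
set nu := ro C - (delta_mx 0 i + delta_mx 0 j).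
have roE k l m r : ro (delta_mx k l + delta_mx m r) = delta_mx 0 k + delta_mx 0 m.
  by rewrite roD !ro_delta.
rewrite /tbar_prod /weight !roE -/nu.
have coA : co A = delta_mx 0 a + (ro C - delta_mx 0 i) by rewrite coD co_delta co_diag.
have AE : A = delta_mx i a + diag_mx (nu + delta_mx 0 j).
  by rewrite /A /nu opprD addrA subrK.
have roCi : ro C 0 i - 1 = nu 0 i + (i == j)%:R.
  by rewrite !mxE !eqxx /=; ring.
case: (co A =P ro B) => [AB|nAB].
  have BE : B = delta_mx j b + diag_mx (nu + delta_mx 0 a).
    rewrite /B; congr (_ + diag_mx _); apply: (addrI (delta_mx 0 j)).
    by rewrite -roB -AB coA /nu; apply/rowP => x; rewrite !mxE; ring.
  have roBj : ro B 0 j - 1 = nu 0 j + (a == j)%:R.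
    rewrite BE roD ro_delta ro_diag !mxE !eqxx /= [j == a]eq_sym; ring.
  rewrite roCi roBj [in K_const _ _ _]AE [in K_const _ _ _]BE K_const_upper //.
  apply: regroup_weight; rewrite -expfzDr ?qv_neq0 // exprnP -expfzDr ?qv_neq0 //.
  by congr (qv ^ _); rewrite -!(inj_eq val_inj) /=; lia.
rewrite [K_const _ _ _](_ : _ = 0) ?mulr0; last first.
  by rewrite /K_const (introF eqP nAB).
(* If the factors are not composable, [C] has the wrong column sums for either family and both
   weights vanish. *)
have coC_neq : co C <> delta_mx 0 a + delta_mx 0 b + nu.
  move=> coC; case: nAB; rewrite coA roB coC /nu.
  by apply/rowP => x; rewrite !mxE; ring.
rewrite (introF (C =P _)) => [|CE].
  rewrite (introF (C =P _)) => [|CE]; first by rewrite !mulr0 addr0 mulr0.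
  by case: coC_neq; rewrite {1}CE !coD !co_delta co_diag [delta_mx 0 a + _]addrC.
by case: coC_neq; rewrite {1}CE !coD !co_delta co_diag.
Qed.

End Tbar.

Theorem proposition3p2p2 (n : nat) (n_gt0 : (0 < n)%N) :
  (forall i j : 'I_n, algU (tbar i j)) /\
  (forall i j a b : 'I_n,
     qv ^- (i == j) *: hatK_mul (tbar i a) (tbar j b)
     - qv ^- (a == b) *: hatK_mul (tbar j b) (tbar i a)
     = ((qv^-1 - qv) * ((b < a)%N%:R - (i < j)%N%:R))
         *: hatK_mul (tbar j a) (tbar i b)).
Proof.
split=> [i j S _|i j a b]; first exact.
apply: val_inj; apply: funext => C.
pose x := weight i j (delta_mx i a + delta_mx j b) C.
pose y := weight i j (delta_mx i b + delta_mx j a) C.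
have E1 : hatK_mul (tbar i a) (tbar j b) C = tbar_prod qv i a j b x y.
  exact: hatK_mul_tbarE.
have weightC E : weight j i E C = weight i j E C.
  by rewrite /weight; case: ifP => // _; rewrite addrC.
have E2 : hatK_mul (tbar j b) (tbar i a) C = tbar_prod qv j b i a x y.
  rewrite hatK_mul_tbarE !weightC [delta_mx j b + _]addrC.
  by rewrite [delta_mx j a + _]addrC.
(* Here [E_ja + E_ib] is the split family, so [x] and [y] trade places. *)
have E3 : hatK_mul (tbar j a) (tbar i b) C = tbar_prod qv j a i b y x.
  rewrite hatK_mul_tbarE !weightC [delta_mx j b + _]addrC.
  by rewrite [delta_mx j a + _]addrC.
transitivity (qv ^- (i == j) * tbar_prod qv i a j b x y
              - qv ^- (a == b) * tbar_prod qv j b i a x y).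
  by rewrite -E1 -E2.
rewrite -[RHS]/(((qv^-1 - qv) * ((b < a)%N%:R - (i < j)%N%:R)) *
  hatK_mul (tbar j a) (tbar i b) C) E3.
apply: tbar_prod_relation; first exact: qv_neq0.
rewrite !(inj_eq val_inj) /x /y => /orP[]/eqP->; last by [].
by rewrite [delta_mx j a + _]addrC.
Qed.
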